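(* Let $R$ be a Cohen-Macaulay local ring with canonical module $\omega_R$, and let $M$ and $N$ be finitely generated $R$-modules with $N$ maximal Cohen-Macaulay. Assume that: (i) $\operatorname{Ext}^j_R(M,N)=0$ for all $j>0$; (ii) $N^\dagger$ is a test module. Then $M$ is free. In particular, if $M=N$ then $R$ is $G$-regular.
   Context: All rings are commutative, unital and Noetherian. $N^\dagger=\operatorname{Hom}_R(N,\omega_R)$. A maximal Cohen-Macaulay module is a nonzero finitely generated module whose depth equals $\dim R$. A finitely generated $R$-module $T$ is a test module if every finitely generated $R$-module $X$ with $\operatorname{Tor}^R_i(T,X)=0$ for all $i\gg0$ satisfies $\operatorname{pd}_RX<\infty$. A local ring $R$ is $G$-regular if $\operatorname{G-dim}_RX=\operatorname{pd}_RX$ for every finitely generated $R$-module $X$, where $\operatorname{G-dim}$ is (Auslander's) Gorenstein dimension; equivalently, every totally reflexive $R$-module is free, where a finitely generated reflexive module $X$ is totally reflexive if $\operatorname{Ext}^i_R(X,R)=\operatorname{Ext}^i_R(\operatorname{Hom}_R(X,R),R)=0$ for all $i>0$. *)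

(* Defs.v *)
From HB Require Import structures.
From mathcomp Require Import all_boot all_order all_algebra.
From mathcomp Require Import ring_quotient boolp.

Set Implicit Arguments.
Unset Strict Implicit.
Unset Printing Implicit Defensive.
Import GRing.Theory.
Local Open Scope ring_scope.
Local Open Scope quotient_scope.

Definition LinHom (R : comNzRingType) (U V : lmodType R) := {linear U -> V}.

Section HomModule.
Variables (R : comNzRingType) (U V : lmodType R).
Implicit Types f g h : LinHom U V.

HB.instance Definition _ := gen_eqMixin (LinHom U V).
HB.instance Definition _ := gen_choiceMixin (LinHom U V).

Lemma Hom_ext f g : (forall x, f x = g x) -> f = g.
Proof.
case: f g => [f cf] [g cg] /= fg; have {fg} efg : f = g by apply: funext.
rewrite efg in cf *; congr GRing.Linear.Pack.
case: cf cg => [[p] [q]] [[p'] [q']].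
by rewrite (Prop_irrelevance p p') (Prop_irrelevance q q').
Qed.

Definition hom_zero : LinHom U V := \0.
Definition hom_add f g : LinHom U V := f \+ g.
Definition hom_opp f : LinHom U V := \- f.
Definition hom_scale (a : R) f : LinHom U V := a \*: f.

Fact hom_addA : associative hom_add.
Proof. by move=> f g h; apply: Hom_ext => x /=; rewrite addrA. Qed.
Fact hom_addC : commutative hom_add.
Proof. by move=> f g; apply: Hom_ext => x /=; rewrite addrC. Qed.
Fact hom_add0 : left_id hom_zero hom_add.
Proof. by move=> f; apply: Hom_ext => x /=; rewrite add0r. Qed.
Fact hom_addN : left_inverse hom_zero hom_opp hom_add.
Proof. by move=> f; apply: Hom_ext => x /=; rewrite addNr. Qed.

HB.instance Definition _ :=
  GRing.isZmodule.Build (LinHom U V) hom_addA hom_addC hom_add0 hom_addN.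

Fact hom_scaleA a b f : hom_scale a (hom_scale b f) = hom_scale (a * b) f.
Proof. by apply: Hom_ext => x /=; rewrite scalerA. Qed.
Fact hom_scale1 : left_id 1 hom_scale.
Proof. by move=> f; apply: Hom_ext => x /=; rewrite scale1r. Qed.
Fact hom_scaleDr : right_distributive hom_scale +%R.
Proof. by move=> a f g; apply: Hom_ext => x /=; rewrite scalerDr. Qed.
Fact hom_scaleDl f : {morph hom_scale^~ f : a b / a + b}.
Proof. by move=> a b; apply: Hom_ext => x /=; rewrite scalerDl. Qed.

HB.instance Definition _ := GRing.Zmodule_isLmodule.Build R (LinHom U V)
  hom_scaleA hom_scale1 hom_scaleDr hom_scaleDl.

End HomModule.

Section BasicModules.
Variable R : comNzRingType.
Implicit Types U V W : lmodType R.

Definition zero_module V := forall v : V, v = 0.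

Definition isomorphic U V := exists f : {linear U -> V}, bijective f.

Definition surjective (A B : Type) (f : A -> B) := forall y, exists x, f x = y.

Definition exact_at U V W (f : {linear U -> V}) (g : {linear V -> W}) :=
  forall v, g v = 0 <-> exists u, f u = v.

Definition in_span V (s : seq V) (v : V) :=
  exists a : 'I_(size s) -> R, v = \sum_(i < size s) a i *: s`_i.

Definition fin_gen V := exists s : seq V, forall v, in_span s v.

Definition free_module V := exists n, isomorphic 'rV[R]_n V.

Definition projective (P : lmodType R) :=
  forall (U V : lmodType R) (g : {linear U -> V}) (f : {linear P -> V}),
  surjective g -> exists h : {linear P -> U}, forall x, g (h x) = f x.

Definition injective_module (I : lmodType R) :=
  forall (U V : lmodType R) (g : {linear U -> V}) (f : {linear U -> I}),
  injective g -> exists h : {linear V -> I}, forall x, h (g x) = f x.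

End BasicModules.

Section QuotientModule.
Variables (R : comNzRingType) (V : lmodType R).
Variables (B : {pred V}) (subB : submod_closed B).

(* A copy of B that carries the proof that it is a submodule, so that the
   quotients of Z-modules of the library apply to it. *)
Definition qpred (_ : submod_closed B) : V -> bool := fun v => v \in B.

Fact qpred_closed : subsemimod_closed (qpred subB).
Proof. exact: subB. Qed.

HB.instance Definition _ :=
  GRing.isSubmodClosed.Build R V (qpred subB) qpred_closed.

Definition quot_module :=
  Quotient.quot (GRing.ZmodClosed.clone V (qpred subB) _).

HB.instance Definition _ := GRing.Zmodule.on quot_module.

Definition quot_pi (v : V) : quot_module := \pi v.

Lemma quot_piP u v : quot_pi u = quot_pi v <-> u - v \in B.
Proof.
have -> : (u - v \in B) = (u == v %[mod quot_module]).
  by rewrite -Quotient.idealrBE.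
by split=> /eqP.
Qed.

Lemma quot_pi_surj : surjective quot_pi.
Proof. by move=> x; exists (repr x); rewrite /quot_pi reprK. Qed.

Lemma quot_piD : {morph quot_pi : u v / u + v}.
Proof. by move=> u v; rewrite /quot_pi; rewrite piE. Qed.

Lemma quot_pi0 : quot_pi 0 = 0.
Proof. by apply: (addrI (quot_pi 0)); rewrite -quot_piD !addr0. Qed.

Definition quot_scale (a : R) (x : quot_module) := quot_pi (a *: repr x).

Lemma quot_piZ a v : quot_scale a (quot_pi v) = quot_pi (a *: v).
Proof.
apply/quot_piP; rewrite -scalerBr; have [B0 BL] := subB.
rewrite -[_ *: _]addr0 BL //.
by apply/quot_piP; rewrite /quot_pi reprK.
Qed.

Fact quot_scaleA a b x : quot_scale a (quot_scale b x) = quot_scale (a * b) x.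
Proof. by have [v <-] := quot_pi_surj x; rewrite !quot_piZ scalerA. Qed.
Fact quot_scale1 : left_id 1 quot_scale.
Proof. by move=> x; have [v <-] := quot_pi_surj x; rewrite quot_piZ scale1r. Qed.
Fact quot_scaleDr : right_distributive quot_scale +%R.
Proof.
move=> a x y; have [u <-] := quot_pi_surj x; have [v <-] := quot_pi_surj y.
by rewrite -quot_piD !quot_piZ scalerDr quot_piD.
Qed.
Fact quot_scaleDl x : {morph quot_scale^~ x : a b / a + b}.
Proof.
by move=> a b; have [v <-] := quot_pi_surj x; rewrite !quot_piZ scalerDl quot_piD.
Qed.

HB.instance Definition _ := GRing.Zmodule_isLmodule.Build R quot_module
  quot_scaleA quot_scale1 quot_scaleDr quot_scaleDl.

End QuotientModule.

Section Homology.
Variables (R : comNzRingType) (U V W : lmodType R).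
Variables (f : {linear U -> V}) (g : {linear V -> W}).

Definition ker_pred (h : {linear V -> W}) : V -> bool := fun v => h v == 0.

Fact ker_pred_closed : subsemimod_closed (ker_pred g).
Proof.
split=> [|a v]; last first.
  by rewrite !unfold_in /ker_pred linearZ_LR => /eqP ->; rewrite scaler0.
split=> [|u v]; rewrite !unfold_in /ker_pred ?linear0 // linearD.
by move=> /eqP -> /eqP ->; rewrite addr0.
Qed.

HB.instance Definition _ :=
  GRing.isSubmodClosed.Build R V (ker_pred g) ker_pred_closed.

Definition ker_module := {v : V | ker_pred g v}.

HB.instance Definition _ := SubChoice.on ker_module.
HB.instance Definition _ := [SubChoice_isSubLmodule of ker_module by <:].

Definition im_pred : {pred ker_module} := fun z => `[< exists u, f u = val z >].

Fact im_pred_closed : submod_closed im_pred.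
Proof.
split=> [|a x y]; rewrite !unfold_in.
  by apply/asboolP; exists 0; rewrite !linear0.
move=> /asboolP[u ux] /asboolP[v vy]; apply/asboolP; exists (a *: u + v).
by rewrite !linearP ux vy.
Qed.

(* ker g / (im f :&: ker g). *)
Definition homology : lmodType R := quot_module im_pred_closed.

Lemma homology_eq0 :
  zero_module homology <-> forall v, g v = 0 -> exists u, f u = v.
Proof.
split=> [h v /eqP gv|h x].
  have := h (quot_pi im_pred_closed (exist _ v gv)).
  by rewrite -(quot_pi0 im_pred_closed) => /quot_piP; rewrite subr0 => /asboolP.
have [[v gv] <-] := quot_pi_surj x; rewrite -(quot_pi0 im_pred_closed).
by apply/quot_piP; rewrite subr0; apply/asboolP/h/eqP.
Qed.

End Homology.

Section MatrixAction.
Variables (R : comNzRingType) (V : lmodType R) (p q : nat) (A : 'M[R]_(p, q)).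

Definition mxact (x : {ffun 'I_q -> V}) : {ffun 'I_p -> V} :=
  [ffun a => \sum_b A a b *: x b].

Fact mxact_linear : linear mxact.
Proof.
move=> c x y; apply/ffunP => a; rewrite !ffunE scaler_sumr -big_split /=.
by apply: eq_bigr => b _; rewrite !ffunE scalerDr !scalerA mulrC.
Qed.

HB.instance Definition _ :=
  GRing.isLinear.Build R {ffun 'I_q -> V} {ffun 'I_p -> V} *:%R mxact
    mxact_linear.

End MatrixAction.
Arguments mxact {R} V {p q} A x.

(* A resolution of M by the modules F_i = R^(rk i) of row vectors; the
   differential F_(i+1) -> F_i is v |-> v *m diff i. *)
Record free_resolution (R : comNzRingType) (M : lmodType R) := FreeResolution {
  rk : nat -> nat;
  diff : forall i, 'M[R]_(rk i.+1, rk i);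
  aug : {linear 'rV[R]_(rk 0) -> M};
  aug_surj : surjective aug;
  exact_aug : exact_at (@mulmxr R 1 _ _ (diff 0)) aug;
  exact_diff : forall i, 
    exact_at (@mulmxr R 1 _ _ (diff i.+1)) (@mulmxr R 1 _ _ (diff i))
}.

Section ExtTor.
Variable R : comNzRingType.

(* Hom_R(F_i, N) is identified with N^(rk i) through the images of the
   canonical basis vectors: precomposition with the differential becomes the
   action of diff i. *)
Definition Ext (M N : lmodType R) (F : free_resolution M) (i : nat) :
    lmodType R :=
  if i is j.+1 then homology (mxact N (diff F j)) (mxact N (diff F j.+1))
  else homology
    (\0 : {linear {ffun 'I_(rk F 0) -> N} -> {ffun 'I_(rk F 0) -> N}})
    (mxact N (diff F 0)).

(* T (x) F_i is identified with T^(rk i): 1 (x) differential becomes the action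
   of the transpose of diff i. *)
Definition Tor (T X : lmodType R) (F : free_resolution X) (i : nat) :
    lmodType R :=
  if i is j.+1 then homology (mxact T (diff F j.+1)^T) (mxact T (diff F j)^T)
  else homology (mxact T (diff F 0)^T)
    (\0 : {linear {ffun 'I_(rk F 0) -> T} -> {ffun 'I_(rk F 0) -> T}}).

(* For the finitely generated modules over Noetherian rings considered here a
   free_resolution exists (free_resolution_exists below), and these modules do
   not depend on it up to isomorphism. *)
Definition Ext_vanishes (i : nat) (M N : lmodType R) :=
  forall F : free_resolution M, zero_module (Ext N F i).

Definition Tor_vanishes (i : nat) (T X : lmodType R) :=
  forall F : free_resolution X, zero_module (Tor T F i).

End ExtTor.

Section Dimensions.
Variable R : comNzRingType.
Implicit Types M N X C : lmodType R.

(* Resolutions 0 -> F_n -> ... -> F_0 -> X -> 0 with all the F_i in P. *)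
Definition left_resolution_le (P : lmodType R -> Prop) (X : lmodType R)
    (n : nat) :=
  exists (F : nat -> lmodType R) (d : forall i, {linear F i.+1 -> F i})
         (e : {linear F 0 -> X}),
  [/\ forall i, (i <= n)%N -> P (F i),
      forall i, (n < i)%N -> zero_module (F i),
      surjective e, exact_at (d 0) e
    & forall i, exact_at (d i.+1) (d i)].

Definition pd_le := left_resolution_le (@projective R).

Definition finite_pd X := exists n, pd_le X n.

Definition id_le (X : lmodType R) (n : nat) :=
  exists (J : nat -> lmodType R) (e : {linear X -> J 0})
         (d : forall i, {linear J i -> J i.+1}),
  [/\ forall i, (i <= n)%N -> injective_module (J i),
      forall i, (n < i)%N -> zero_module (J i),
      injective e, exact_at e (d 0)
    & forall i, exact_at (d i) (d i.+1)].

Definition finite_id X := exists n, id_le X n.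

Definition bidual_ev X (x : X) (f : LinHom X R^o) : R^o := f x.

Fact bidual_ev_linear X (x : X) : linear (bidual_ev x).
Proof. by []. Qed.

HB.instance Definition _ X (x : X) :=
  GRing.isLinear.Build R (LinHom X R^o) R^o *:%R (bidual_ev x)
    (bidual_ev_linear x).

Definition bidual X (x : X) : LinHom (LinHom X R^o) R^o := bidual_ev x.

Definition totally_reflexive X :=
  [/\ fin_gen X, bijective (@bidual X),
      forall i, (0 < i)%N -> Ext_vanishes i X R^o
    & forall i, (0 < i)%N -> Ext_vanishes i (LinHom X R^o) R^o].

Definition Gdim_le := left_resolution_le totally_reflexive.

(* G-dim X = pd X in {-oo} + nat + {+oo}: the two dimensions have the same
   upper bounds. *)
Definition G_regular :=
  forall X, fin_gen X -> forall n, Gdim_le X n <-> pd_le X n.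

Definition test_module (T : lmodType R) :=
  fin_gen T /\
  forall X, fin_gen X ->
    (exists n, forall i, (n < i)%N -> Tor_vanishes i T X) -> finite_pd X.

End Dimensions.

Section LocalRings.
Variable R : comNzRingType.

Definition noetherian :=
  forall I : {pred R^o}, submod_closed I ->
  exists s : seq R^o, forall x, x \in I <-> in_span s x.

(* idealr R is the type of proper ideals of R. *)
Definition maximal_ideal (I : idealr R) :=
  forall J : idealr R, (forall x, I x -> J x) -> forall x, J x -> I x.

Definition local_ring (m : idealr R) :=
  maximal_ideal m /\
  forall I : idealr R, maximal_ideal I -> forall x, I x = m x.

Definition prime_chain (n : nat) (p : nat -> prime_idealr R) :=
  forall i, (i < n)%N ->
    (forall x, p i x -> p i.+1 x) /\ exists x, p i.+1 x /\ ~ p i x.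

Definition krull_dim (d : nat) :=
  (exists p, prime_chain d p) /\ forall n p, prime_chain n p -> (n <= d)%N.

Variable m : idealr R.

Fact ideal_submod_closed : submod_closed (m : {pred R^o}).
Proof.
split=> [|a x y mx my]; first exact: idealr0.
by rewrite rpredD ?[a *: x]/(_ * _) ?idealMr.
Qed.

Definition residue_field : lmodType R := quot_module ideal_submod_closed.

Definition in_smul (M : lmodType R) (s : seq R) (v : M) :=
  exists u : 'I_(size s) -> M, v = \sum_(i < size s) s`_i *: u i.

(* in_smul s v means that v lies in (s)M. *)
Definition regular_sequence (M : lmodType R) (s : seq R) :=
  (forall i, (i < size s)%N -> forall u : M,
     in_smul (take i s) (s`_i *: u) -> in_smul (take i s) u) /\
  exists v : M, ~ in_smul s v.

Definition depth (M : lmodType R) (n : nat) :=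
  (exists s, [/\ {in s, forall x, m x}, regular_sequence M s & size s = n]) /\
  forall s, {in s, forall x, m x} -> regular_sequence M s -> (size s <= n)%N.

Definition cohen_macaulay := exists d, krull_dim d /\ depth R^o d.

Definition maximal_CM (M : lmodType R) :=
  [/\ ~ zero_module M, fin_gen M & exists d, krull_dim d /\ depth M d].

(* The type of C, dim_k Ext^t(k, C) for t = depth C, is 1: as Ext^t(k, C) is
   annihilated by m, this means that it is isomorphic to k. *)
Definition type_one (C : lmodType R) :=
  exists t, depth C t /\
  forall F : free_resolution residue_field,
    isomorphic residue_field (Ext C F t).

(* The definition of Bruns and Herzog, Cohen-Macaulay rings. *)
Definition canonical_module (C : lmodType R) :=
  [/\ maximal_CM C, type_one C & finite_id C].

End LocalRings.

Section Existence.
Variable R : comNzRingType.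

Lemma submod_rV_fin_gen (R_noeth : noetherian R) n (K : {pred 'rV[R]_n}) :
  submod_closed K ->
  exists p (A : 'M[R]_(p, n)),
    forall v, v \in K <-> exists u : 'rV_p, u *m A = v.
Proof.
elim: n K => [|n IHn] K [K0 KL].
  exists 0%N, 0 => v; rewrite (thinmx0 v) K0; split=> // _; exists 0.
  by rewrite mulmx0.
pose I : {pred R^o} := fun x => `[< exists2 v, v \in K & v 0 0 = x >].
have /R_noeth[s Is] : submod_closed I.
  split=> [|a x y]; rewrite !unfold_in.
    by apply/asboolP; exists 0; rewrite ?mxE.
  move=> /asboolP[u Ku <-] /asboolP[v Kv <-]; apply/asboolP.
  by exists (a *: u + v); rewrite ?KL ?mxE.
pose J : {pred 'rV[R]_n} := fun w => (row_mx (0 : 'rV_1) w : 'rV_n.+1) \in K.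
have [|q [A' JA']] := IHn J.
  split=> [|a x y]; rewrite !unfold_in.
    by rewrite row_mx0.
  move=> Kx Ky; suff -> : row_mx (0 : 'rV_1) (a *: x + y) =
    a *: row_mx (0 : 'rV_1) x + row_mx (0 : 'rV_1) y by exact: KL.
  by rewrite scale_row_mx add_row_mx scaler0 addr0.
have Ks (i : 'I_(size s)) : exists v, (v \in K) && (v 0 0 == s`_i).
  have : s`_i \in I.
    apply/Is; exists (fun j => (j == i)%:R); rewrite (bigD1 i) //= eqxx scale1r.
    by rewrite big1 ?addr0 // => j /negPf ->; rewrite scale0r.
  by move=> /asboolP[v Kv <-]; exists v; rewrite Kv eqxx.
have KD u v : u \in K -> v \in K -> u + v \in K.
  by move=> Ku Kv; rewrite -[u]scale1r KL.
have KZ a v : v \in K -> a *: v \in K.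
  by move=> Kv; rewrite -[_ *: _]addr0 KL.
pose b i := xchoose (Ks i).
have bK i : b i \in K by have /andP[] := xchooseP (Ks i).
have b0 i : b i 0 0 = s`_i by have /andP[_ /eqP] := xchooseP (Ks i).
pose B : 'M[R]_(size s, n.+1) := \matrix_i b i.
have BK (u : 'rV_(size s)) : u *m B \in K.
  rewrite mulmx_sum_row; elim/big_ind: _ => // i _.
  by apply: KZ; rewrite rowK.
have zA' (z : 'rV_q) : z *m (row_mx (0 : 'cV_q) A' : 'M_(q, n.+1)) =
    (row_mx (0 : 'rV_1) (z *m A') : 'rV_n.+1).
  by have := @mul_mx_row R 1 q 1 n z 0 A'; rewrite mulmx0.
exists (size s + q)%N, (col_mx B (row_mx (0 : 'cV_q) A')) => v; split=> [Kv|[u <-]].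
  have /Is[a va] : v 0 0 \in I by apply/asboolP; exists v.
  pose u : 'rV_(size s) := \row_i a i.
  pose w := v - u *m B.
  have Kw : w \in K by rewrite /w addrC -scaleN1r KL.
  have w0 : w = row_mx (0 : 'rV_1) (@rsubmx _ 1 1 n w).
    rewrite -[LHS](@hsubmxK _ 1 1 n).
    suff -> : @lsubmx _ 1 1 n w = 0 by [].
    apply/rowP => j; rewrite !mxE (_ : lshift n j = 0); last first.
      by apply/val_inj; rewrite /= (ord1 j).
    rewrite va; apply/eqP; rewrite subr_eq0; apply/eqP/eq_bigr => i _.
    by rewrite !mxE b0.
  have /JA'[z zw] : @rsubmx _ 1 1 n w \in J by rewrite unfold_in -w0.
  exists (row_mx u z); rewrite mul_row_col zA' zw -w0 /w.
  by rewrite addrC subrK.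
rewrite -[u]hsubmxK mul_row_col zA'; apply: KD => //.
have : rsubmx u *m A' \in J by apply/JA'; exists (rsubmx u).
by [].
Qed.

Lemma free_resolution_exists (R_noeth : noetherian R) (M : lmodType R) :
  fin_gen M -> inhabited (free_resolution M).
Proof.
move=> [s sM].
pose f (u : 'rV[R]_(size s)) := \sum_(i < size s) u 0 i *: s`_i.
have lin_f : linear f.
  move=> a u v; rewrite /f scaler_sumr -big_split /=; apply: eq_bigr => i _.
  by rewrite !mxE scalerDl scalerA.
pose e : {linear 'rV[R]_(size s) -> M} :=
  HB.pack f (GRing.isLinear.Build R 'rV[R]_(size s) M *:%R f lin_f).
have step n (U : lmodType R) (g : {linear 'rV[R]_n -> U}) :
    {x : {p & 'M[R]_(p, n)} | exact_at (@mulmxr R 1 _ _ (tagged x)) g}.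
  apply: cid; pose K : {pred 'rV[R]_n} := fun v => g v == 0.
  have [|p [A KA]] := @submod_rV_fin_gen R_noeth n K.
    split=> [|a u v]; rewrite !unfold_in /K ?linear0 // linearP.
    by move=> /eqP -> /eqP ->; rewrite scaler0 addr0.
  exists (existT _ p A) => v; split=> [/eqP gv|uv]; first exact/KA.
  by apply/eqP; apply/KA.
pose S := {n & {p & 'M[R]_(p, n)}}.
pose next (x : S) : S :=
  existT _ (tag (tagged x)) (sval (step _ _ (@mulmxr R 1 _ _ (tagged (tagged x))))).
pose st i := iter i next (existT _ (size s) (sval (step _ _ e))).
have surj_e : surjective e.
  move=> v; have [a ->] := sM v; exists (\row_i a i) => /=.
  by apply: eq_bigr => i _; rewrite mxE.
constructor; apply: (@FreeResolution _ _ (fun i => tag (st i))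
  (fun i => tagged (tagged (st i))) e) => //.
  exact: (svalP (step _ _ e)).
by move=> i; exact: (svalP (step _ _ (@mulmxr R 1 _ _ (tagged (tagged (st i)))))).
Qed.

End Existence.

(* Main.v *)
(* Let J be a finite injective resolution of omega, so that Ext^i(A, omega) is
   the cohomology of Hom(A, J).  By Bass' argument Ext^i(-, omega) vanishes on
   finitely generated modules for i > depth R.  Dividing N by a regular sequence
   of length depth N = depth R raises the degree of a nonzero Ext^i(N, omega) by
   depth R (Nakayama), hence Ext^i(N, omega) = 0 for i > 0.

   Let F be a free resolution of M.  As Ext^j(M, N) = 0 for j > 0, the complex
   Hom(F, N) is exact in positive degrees.  Its cycles Z_i satisfy
   Ext^1(Z_i, omega) = Ext^(1+k)(Z_(i+k), omega), which is zero for k large, so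
   its omega-dual, which is the tensor product of F and N^dagger, is exact too:
   Tor_i(N^dagger, M) = 0 for i > 0, and M has finite projective dimension.

   Finally, if K is the kernel of a minimal free cover G -> L and Ext^1(L, N) = 0,
   then every map K -> N extends to G and so has image in mN; when K is free this
   forces K = 0.  Descending along F, all the syzygies and M itself are free.

   If M = N, the same applies to a totally reflexive X in place of M, because N
   is free and therefore Ext^j(X, N) = 0 for j > 0. *)

Require Import Defs.
From HB Require Import structures.
From mathcomp Require Import all_boot all_order all_algebra.
From mathcomp Require Import ring_quotient boolp.

Set Implicit Arguments.
Unset Strict Implicit.
Unset Printing Implicit Defensive.
Import GRing.Theory.

(** * Linear maps and short exact sequences *)

Section LinearMaps.
Local Open Scope ring_scope.
Variable R : comNzRingType.
Implicit Types A B C D V : lmodType R.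

Lemma linear_exists A B (f : A -> B) :
  linear f -> exists g : {linear A -> B}, g =1 f.
Proof.
move=> lf; pose g : {linear A -> B} :=
  HB.pack f (GRing.isLinear.Build R A B *:%R f lf).
by exists g.
Qed.

Lemma surj_factor B C D (p : {linear B -> C}) (h : {linear B -> D}) :
    surjective p -> (forall b, p b = 0 -> h b = 0) ->
  exists h' : {linear C -> D}, forall b, h' (p b) = h b.
Proof.
move=> p_surj ph.
have hE b b' : p b = p b' -> h b = h b'.
  move=> pb; apply/eqP; rewrite -subr_eq0 -linearB; apply/eqP/ph.
  by rewrite linearB pb subrr.
pose s c := sval (cid (p_surj c)).
have sK c : p (s c) = c := svalP (cid (p_surj c)).
have [|h' h'E] := @linear_exists C D (fun c => h (s c)).
  by move=> a c c'; rewrite -linearP; apply: hE; rewrite linearP !sK.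
by exists h' => b; rewrite h'E; apply: hE; rewrite sK.
Qed.

Lemma inj_factor A B D (i : {linear A -> B}) (h : {linear D -> B}) :
    injective i -> (forall d, exists a, i a = h d) ->
  exists h' : {linear D -> A}, forall d, i (h' d) = h d.
Proof.
move=> i_inj ih; pose s d := sval (cid (ih d)).
have sK d : i (s d) = h d := svalP (cid (ih d)).
have [|h' h'E] := @linear_exists D A s.
  by move=> a c c'; apply: i_inj; rewrite linearP !sK linearP.
by exists h' => d; rewrite h'E sK.
Qed.

Definition submod V (P : V -> Prop) :=
  P 0 /\ forall a u v, P u -> P v -> P (a *: u + v).

Section Submod.
Variables (V : lmodType R) (P : V -> Prop).
Hypothesis subP : submod P.

Lemma submod0 : P 0. Proof. exact: (proj1 subP). Qed.

Lemma submodZ a v : P v -> P (a *: v).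
Proof. have [P0 PL] := subP; move=> Pv; rewrite -[_ *: _]addr0; exact: PL. Qed.

Lemma submodD u v : P u -> P v -> P (u + v).
Proof. have [P0 PL] := subP; move=> Pu Pv; rewrite -[u]scale1r; exact: PL. Qed.

Lemma submodB u v : P u -> P v -> P (u - v).
Proof. by move=> Pu Pv; rewrite -scaleN1r; apply/submodD/submodZ. Qed.

Lemma submod_sum n (a : 'I_n -> R) (u : 'I_n -> V) :
  (forall i, P (u i)) -> P (\sum_i a i *: u i).
Proof.
move=> Pu; elim/big_ind: _ => [|x y|i _]; first exact: submod0.
  exact: submodD.
exact: submodZ.
Qed.

Lemma quotient_exists : exists (Q : lmodType R) (q : {linear V -> Q}),
  surjective q /\ forall v, q v = 0 <-> P v.
Proof.
pose B : {pred V} := fun v => `[< P v >].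
have subB : submod_closed B.
  split=> [|a u v]; rewrite !unfold_in; first exact/asboolP/submod0.
  by move=> /asboolP Pu /asboolP Pv; apply/asboolP/submodD/Pv/submodZ.
have [|q qE] := @linear_exists V (quot_module subB) (quot_pi subB).
  by move=> a u v; rewrite quot_piD -quot_piZ.
exists (quot_module subB), q; split=> [x|v].
  by have [v <-] := quot_pi_surj x; exists v; rewrite qE.
rewrite qE -(quot_pi0 subB); split=> [/quot_piP|Pv].
  by rewrite subr0 => /asboolP.
by apply/quot_piP; rewrite subr0; apply/asboolP.
Qed.

Lemma submodule_exists : exists (S : lmodType R) (i : {linear S -> V}),
  injective i /\ forall v, P v <-> exists s, i s = v.
Proof.
have [Q [q [_ qP]]] := quotient_exists.
have [|i iE] := @linear_exists (ker_module q) V val.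
  by move=> a u v; rewrite linearP.
exists (ker_module q), i; split=> [x y|v]; first by rewrite !iE => /val_inj.
split=> [/qP/eqP qv|[[s qs] <-]]; last by rewrite iE; apply/qP/eqP.
by exists (exist _ v qv); rewrite iE.
Qed.

End Submod.

Definition short_exact A B C (i : {linear A -> B}) (p : {linear B -> C}) :=
  [/\ injective i, exact_at i p & surjective p].

Lemma submod_ker A B (f : {linear A -> B}) : submod (fun v => f v = 0).
Proof.
by split=> [|a u v fu fv]; rewrite ?linear0 // linearP fu fv scaler0 addr0.
Qed.

Lemma submod_im A B (f : {linear A -> B}) : submod (fun v => exists u, f u = v).
Proof.
split=> [|a u v [x <-] [y <-]]; first by exists 0; rewrite linear0.
by exists (a *: x + y); rewrite linearP.
Qed.

Lemma short_exact_ker B C (p : {linear B -> C}) :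
  surjective p -> exists (A : lmodType R) (i : {linear A -> B}), short_exact i p.
Proof.
by move=> ps; have [A [i [ii iP]]] := submodule_exists (submod_ker p); exists A, i.
Qed.

Lemma short_exact_coker A B (i : {linear A -> B}) :
  injective i -> exists (C : lmodType R) (p : {linear B -> C}), short_exact i p.
Proof.
move=> ii; have [C [p [ps pP]]] := quotient_exists (submod_im i).
by exists C, p; split=> // v; rewrite pP.
Qed.

Lemma exact_comp0 A B C (i : {linear A -> B}) (p : {linear B -> C}) :
  exact_at i p -> forall a, p (i a) = 0.
Proof. by move=> ex a; apply/ex; exists a. Qed.

Lemma linear_inj_ker A B (f : {linear A -> B}) :
  (forall a, f a = 0 -> a = 0) -> injective f.
Proof.
move=> f0 x y fxy; apply/eqP; rewrite -subr_eq0; apply/eqP/f0.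
by rewrite linearB fxy subrr.
Qed.

Lemma short_exact_mul A C (p : {linear A -> C}) (x : R) :
    (forall a : A, x *: a = 0 -> a = 0) -> surjective p ->
    (forall a, p a = 0 <-> exists b, a = x *: b) ->
  exists2 f : {linear A -> A}, short_exact f p & forall a, f a = x *: a.
Proof.
move=> x_reg ps pP; have [|f fE] := @linear_exists A A (fun a => x *: a).
  by move=> a u v; rewrite scalerDr !scalerA mulrC.
exists f => //; split=> // [|a].
  by apply: linear_inj_ker => a; rewrite fE; apply: x_reg.
by rewrite pP; split=> [[b ->]|[b <-]]; exists b; rewrite fE.
Qed.

Lemma scale_map V (v : V) :
  exists h : {linear R^o -> V}, forall a : R, h a = a *: v.
Proof.
have [|h hE] := @linear_exists R^o V (fun a : R^o => (a : R) *: v).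
  by move=> a b c; rewrite scalerDl scalerA.
by exists h.
Qed.

Definition single V n (b : 'I_n) (x : V) : {ffun 'I_n -> V} :=
  [ffun a => if a == b then x else 0].

Fact single_linear V n (b : 'I_n) : linear (@single V n b).
Proof.
move=> a u v; apply/ffunP => c; rewrite !ffunE.
by case: eqP => // _; rewrite scaler0 addr0.
Qed.

HB.instance Definition _ V n (b : 'I_n) :=
  GRing.isLinear.Build R V {ffun 'I_n -> V} *:%R (single b) (single_linear b).

Lemma sum_single V n (x : {ffun 'I_n -> V}) : \sum_b single b (x b) = x.
Proof.
apply/ffunP => a; rewrite sum_ffunE (bigD1 a) //= ffunE eqxx big1 ?addr0 //.
by move=> b ba; rewrite ffunE eq_sym (negPf ba).
Qed.

Definition comb V n (s : 'I_n -> V) (v : 'rV[R]_n) := \sum_i v 0 i *: s i.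

Fact comb_linear V n (s : 'I_n -> V) : linear (comb s).
Proof.
move=> a u v; rewrite /comb scaler_sumr -big_split /=; apply: eq_bigr => i _.
by rewrite !mxE scalerDl scalerA.
Qed.

HB.instance Definition _ V n (s : 'I_n -> V) :=
  GRing.isLinear.Build R 'rV[R]_n V *:%R (comb s) (comb_linear s).

Lemma combE V n (f : {linear 'rV[R]_n -> V}) v :
  f v = comb (fun i => f (delta_mx 0 i)) v.
Proof.
rewrite {1}[v]row_sum_delta linear_sum.
by apply: eq_bigr => i _; rewrite linearZ.
Qed.

Lemma comb_delta V n (s : 'I_n -> V) i : comb s (delta_mx 0 i) = s i.
Proof.
rewrite /comb (bigD1 i) //= mxE !eqxx scale1r big1 ?addr0 // => j ji.
by rewrite mxE (negPf ji) andbF scale0r.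
Qed.

Lemma comb_row V n (a : 'I_n -> R) (s : 'I_n -> V) :
  comb s (\row_i a i) = \sum_i a i *: s i.
Proof. by apply: eq_bigr => i _; rewrite mxE. Qed.

Lemma fin_genP V :
  fin_gen V <-> exists n (s : 'I_n -> V), surjective (comb s).
Proof.
split=> [[s sV]|[n [s sV]]].
  exists (size s), (fun i => s`_i) => v; have [a ->] := sV v.
  by exists (\row_i a i); rewrite comb_row.
have sz : size (mkseq (fun i => if insub i is Some j then s j else 0) n) = n.
  by rewrite size_mkseq.
exists (mkseq (fun i => if insub i is Some j then s j else 0) n) => v.
have [u <-] := sV v; exists (fun i => u 0 (cast_ord sz i)).
rewrite /comb (reindex (cast_ord sz)) /=; last first.
  by apply: onW_bij; exists (cast_ord (esym sz)) => i; apply: val_inj.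
apply: eq_bigr => i _; congr (_ *: _).
have i_n : (i < n)%N by rewrite -[n in (_ < n)%N]sz.
by rewrite nth_mkseq // insubT; congr s; apply: val_inj.
Qed.

Lemma fin_gen_surj A B (p : {linear A -> B}) :
  surjective p -> fin_gen A -> fin_gen B.
Proof.
move=> ps /fin_genP[n [s sA]]; apply/fin_genP; exists n, (p \o s) => b.
have [a <-] := ps b; have [u <-] := sA a; exists u.
by rewrite linear_sum; apply: eq_bigr => i _; rewrite linearZ.
Qed.

Lemma fin_gen_rV n : fin_gen 'rV[R]_n.
Proof.
by apply/fin_genP; exists n, (delta_mx 0) => v; exists v; rewrite /comb -row_sum_delta.
Qed.

Lemma fin_gen_R : fin_gen R^o.
Proof.
apply/fin_genP; exists 1%N, (fun=> 1) => a; exists (const_mx a).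
by rewrite /comb big_ord1 mxE [_ *: _]mulr1.
Qed.

(** The preimage of [A] in a free cover of [B] is generated by the rows of a matrix [D], and it maps
    onto [A]. *)
Lemma fin_gen_inj A B (i : {linear A -> B}) :
  noetherian R -> injective i -> fin_gen B -> fin_gen A.
Proof.
move=> Rn ii /fin_genP[n [s sB]].
pose K : {pred 'rV[R]_n} := fun v => `[< exists a, i a = comb s v >].
have [|p [D KD]] := @submod_rV_fin_gen R Rn n K.
  split=> [|a u v]; rewrite !unfold_in.
    by apply/asboolP; exists 0; rewrite !linear0.
  move=> /asboolP[x xu] /asboolP[y yv]; apply/asboolP; exists (a *: x + y).
  by rewrite !linearP xu yv.
have [u|f fE] := @inj_factor A B 'rV_p i (comb s \o mulmxr D) ii.
  have : u *m D \in K by apply/KD; exists u.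
  by rewrite unfold_in => /asboolP.
apply: (fin_gen_surj (p := f)) (fin_gen_rV p) => a.
have [v va] := sB (i a).
have /KD[u uv] : v \in K by rewrite unfold_in; apply/asboolP; exists a.
by exists u; apply: ii; rewrite fE /= uv.
Qed.

(** Only the image of [f] has to lie in that of [p], so exactness of a complex is enough to lift. *)
Lemma free_lift A B n (p : {linear A -> B}) (f : {linear 'rV[R]_n -> B}) :
    (forall x, exists a, p a = f x) ->
  exists h : {linear 'rV[R]_n -> A}, forall x, p (h x) = f x.
Proof.
move=> pf; pose s i := sval (cid (pf (delta_mx 0 i))).
exists (comb s) => x; rewrite [RHS]combE linear_sum; apply: eq_bigr => i _.
by rewrite linearZ (svalP (cid (pf _))).
Qed.

End LinearMaps.

(** * Noetherian local rings *)

Section NoetherianInduction.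
Local Open Scope ring_scope.
Variable R : comNzRingType.
Hypothesis Rn : noetherian R.
Implicit Types I J : R^o -> Prop.

(** Without a maximal element, dependent choice yields a strictly increasing sequence of ideals. *)
Lemma noetherian_max (P : (R^o -> Prop) -> Prop) I : submod I -> P I ->
  exists J, [/\ submod J, P J & forall J', submod J' -> P J' ->
    (forall x, J x -> J' x) -> forall x, J' x -> J x].
Proof.
move=> sI PI; apply: contrapT => noJ.
pose T := {J | submod J /\ P J}.
have next (J : T) : {J' : T | (forall x, sval J x -> sval J' x) /\
    exists x, sval J' x /\ ~ sval J x}.
  apply: cid; apply: contrapT => nJ; apply: noJ.
  case: J nJ => J [sJ PJ] /= nJ; exists J; split=> // J' sJ' PJ' JJ' x J'x.
  apply: contrapT => nJx; apply: nJ; exists (exist _ J' (conj sJ' PJ')).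
  by split=> //; exists x.
pose c k : T := iter k (fun J : T => sval (next J)) (exist _ I (conj sI PI)).
have cS k x : sval (c k) x -> sval (c k.+1) x.
  by case: (svalP (next (c k))) => + _; apply.
have c_le k l x : (k <= l)%N -> sval (c k) x -> sval (c l) x.
  by move=> /subnK <-; elim: (l - k)%N => // n IHn /IHn; apply: cS.
(* The union of the chain is finitely generated; its generators all lie in one member [c K], where
   the chain would stop. *)
pose U : {pred R^o} := fun x => `[< exists k, sval (c k) x >].
have [|s Us] := Rn (I := U).
  split=> [|a u v]; rewrite !unfold_in.
    by apply/asboolP; exists 0%N; apply: submod0; case: (svalP (c 0%N)).
  move=> /asboolP[k ku] /asboolP[l lv]; apply/asboolP; exists (maxn k l).
  have [sc _] := svalP (c (maxn k l)); apply: submodD => //.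
    by apply: submodZ => //; apply: c_le ku; rewrite leq_maxl.
  by apply: c_le lv; rewrite leq_maxr.
have sU (i : 'I_(size s)) : exists k, sval (c k) s`_i.
  have : s`_i \in U.
    apply/Us; exists (fun j => (j == i)%:R).
    rewrite (bigD1 i) //= eqxx scale1r big1 ?addr0 // => j /negPf ->.
    by rewrite scale0r.
  by rewrite unfold_in => /asboolP.
pose k i := sval (cid (sU i)); pose K := (\max_i k i)%N.
have [_ [x [cx ncx]]] := svalP (next (c K)); apply: ncx.
have /Us[a ->] : x \in U by rewrite unfold_in; apply/asboolP; exists K.+1.
have [sc _] := svalP (c K); apply: submod_sum => // i.
apply: c_le (svalP (cid (sU i))); exact: (leq_bigmax (F := k)).
Qed.

Lemma noetherian_ind (P : (R^o -> Prop) -> Prop) :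
    (forall J, submod J -> (forall J', submod J' -> (forall x, J x -> J' x) ->
        (exists x, J' x /\ ~ J x) -> P J') -> P J) ->
  forall J, submod J -> P J.
Proof.
move=> IH J sJ; apply: contrapT => nPJ.
have [K [sK nPK Kmax]] := noetherian_max (P := fun J => ~ P J) sJ nPJ.
apply: nPK; apply: IH => // J' sJ' KJ' [x [J'x nKx]]; apply: contrapT => nPJ'.
exact/nKx/(Kmax J').
Qed.

End NoetherianInduction.

Section LocalAlgebra.
Local Open Scope ring_scope.
Variable R : comNzRingType.

Definition local_at (m : R^o -> Prop) :=
  [/\ submod m, ~ m 1 & forall x, ~ m x -> exists y : R, y * x = 1].

(** An ideal maximal among the proper ideals containing a nonunit [x] is a maximal ideal, hence
    equal to [m]. *)
Lemma local_ring_at (m : idealr R) :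
  noetherian R -> local_ring m -> local_at (fun x => x \in m).
Proof.
move=> Rn [_ m_uniq]; split=> [|| x nmx].
- by split=> [|a u v mu mv]; rewrite ?idealr0 // rpredD ?[a *: u]/(_ * _) ?idealMr.
- by rewrite idealr1.
apply: contrapT => nx.
pose P (J : R^o -> Prop) := J x /\ ~ J 1.
have sx : submod (fun z : R^o => exists y : R, y * x = z).
  split=> [|a u v [y <-] [z <-]]; first by exists 0; rewrite mul0r.
  by exists (a * y + z); rewrite mulrDl -mulrA.
have [|J [sJ [Jx nJ1] Jmax]] := noetherian_max Rn (P := P) sx.
  by split; first by exists 1; rewrite mul1r.
pose I : {pred R} := fun x => `[< J x >].
have I_id : idealr_closed I.
  split.
  - by apply/asboolP; apply: (submod0 sJ).
  - by apply/negP => /asboolP.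
  move=> a u v; rewrite !unfold_in => /asboolP Ju /asboolP Jv; apply/asboolP.
  exact: (proj2 sJ a u v).
pose Ir : idealr R := HB.pack I (isIdealr.Build R I I_id).
have I_max : maximal_ideal Ir.
  move=> J' IJ' y J'y; apply/asboolP; apply: (Jmax (fun x => x \in J')) => //.
  - by split=> [|a u v mu mv]; rewrite ?idealr0 // rpredD ?[a *: u]/(_ * _) ?idealMr.
  - by split; [apply/IJ'/asboolP | rewrite idealr1].
  - by move=> z Jz; apply/IJ'/asboolP.
by apply: nmx; rewrite -topredE /= -(m_uniq _ I_max); apply/asboolP.
Qed.

Variable m : R^o -> Prop.
Hypothesis Rloc : local_at m.

Lemma local_sub_unit (c : R) : m c -> exists y : R, y * (1 - c) = 1.
Proof.
case: Rloc => sm nm1 mu mc; apply: mu => m1c; apply: nm1.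
by rewrite -[1](subrK c); apply: (submodD sm).
Qed.

(** A relative form, with [Z] finitely generated modulo [B] and contained in mZ + B: it applies to
    cocycles modulo coboundaries without forming the quotient. The generators are eliminated one at
    a time. *)
Lemma nakayama (V : lmodType R) (Z B : V -> Prop) n (s : 'I_n -> V) :
    submod Z -> submod B -> (forall i, Z (s i)) ->
    (forall z, Z z -> exists (a : 'I_n -> R) b, B b /\ z = \sum_i a i *: s i + b) ->
    (forall z, Z z -> exists k (a : 'I_k -> R) (u : 'I_k -> V) b,
      [/\ forall i, m (a i), forall i, Z (u i), B b
        & z = \sum_i a i *: u i + b]) ->
  forall z, Z z -> B z.
Proof.
case: (Rloc) => sm _ _.
move=> sZ sB; elim: n s => [|n IHn] s Zs Zspan Zm.
  by move=> z /Zspan[a [b [Bb ->]]]; rewrite big_ord0 add0r.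
apply: (IHn (fun i => s (lift ord_max i))) => // z Zz.
have sE (a : 'I_n.+1 -> R) : \sum_i a i *: s i =
    a ord_max *: s ord_max + \sum_i a (lift ord_max i) *: s (lift ord_max i).
  by rewrite (bigD1_ord ord_max).
have [c [b [mc Bb cb]]] : exists (c : 'I_n.+1 -> R) b,
    [/\ forall i, m (c i), B b & s ord_max = \sum_i c i *: s i + b].
  have [k [a [u [b [ma Zu Bb ->]]]]] := Zm _ (Zs ord_max).
  have /choice[d dP] : forall i, exists db : ('I_n.+1 -> R) * V,
      B db.2 /\ u i = \sum_j db.1 j *: s j + db.2.
    by move=> i; have [d0 [b0 [? ?]]] := Zspan _ (Zu i); exists (d0, b0).
  exists (fun j => \sum_i a i * (d i).1 j), (\sum_i a i *: (d i).2 + b); split.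
  - move=> j; elim/big_ind: _ => [|x y|i _]; first exact: (submod0 sm).
      exact: (submodD sm).
    by rewrite mulrC; apply: (@submodZ _ R^o _ sm ((d i).1 j) _ (ma i)).
  - by apply: (submodD sB) => //; apply: (submod_sum sB) => i; case: (dP i).
  rewrite addrA; congr (_ + _); under eq_bigr => i _ do rewrite (dP i).2 scalerDr.
  rewrite big_split /=; congr (_ + _).
  under eq_bigr => i _ do rewrite scaler_sumr.
  rewrite exchange_big /=; apply: eq_bigr => j _; rewrite scaler_suml.
  by apply: eq_bigr => i _; rewrite scalerA.
have [y yc] := local_sub_unit (mc ord_max).
(* As 1 - c is a unit for the coefficient c of the last generator, this generator is a combination
   of the others modulo [B]. *)
have {}cb : s ord_max =
    \sum_i (y * c (lift ord_max i)) *: s (lift ord_max i) + y *: b.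
  under eq_bigr => i _ do rewrite -scalerA.
  rewrite -scaler_sumr -scalerDr -[LHS]scale1r -yc -scalerA; congr (_ *: _).
  rewrite scalerBl scale1r [X in X - _]cb sE.
  by rewrite [LHS]addrC -[X in _ + X]addrA addKr.
have [a [b' [Bb' ->]]] := Zspan z Zz.
exists (fun i => a ord_max * (y * c (lift ord_max i)) + a (lift ord_max i)).
exists (a ord_max *: (y *: b) + b'); split.
  by apply: (submodD sB) => //; do 2!apply: (submodZ sB).
rewrite sE cb scalerDr scaler_sumr [RHS]addrA; congr (_ + _).
under [in RHS]eq_bigr => i _ do rewrite scalerDl -scalerA.
by rewrite big_split /= addrAC.
Qed.

End LocalAlgebra.

Section HomFinGen.
Local Open Scope ring_scope.
Variable R : comNzRingType.
Implicit Types A V W : lmodType R.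

Lemma hom_sumE A V n (a : 'I_n -> R) (s : 'I_n -> LinHom A V) (x : A) :
  (\sum_i a i *: s i : LinHom A V) x = \sum_i a i *: s i x.
Proof.
elim/big_ind2: _ => // u v u' v' <- <-; by [].
Qed.

Lemma fin_gen_ffun V n : fin_gen V -> fin_gen {ffun 'I_n -> V}.
Proof.
move=> /fin_genP[k [s sV]].
have [|f fE] := @linear_exists R 'rV[R]_(n * k) {ffun 'I_n -> V}
    (fun u => [ffun i => comb s (row i (vec_mx u))]).
  by move=> a u v; apply/ffunP => i; rewrite !ffunE !linearP.
apply: (fin_gen_surj (p := f)) (fin_gen_rV _ _) => x.
pose c i := sval (cid (sV (x i))).
exists (mxvec (\matrix_i c i)); rewrite fE; apply/ffunP => i.
by rewrite ffunE mxvecK rowK (svalP (cid (sV (x i)))).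
Qed.

(** Evaluation at generators of [A] embeds Hom(A, W) in a finite power of [W]. *)
Lemma fin_gen_hom A W :
  noetherian R -> fin_gen A -> fin_gen W -> fin_gen (LinHom A W).
Proof.
move=> Rn /fin_genP[n [s sA]] fgW.
have [|f fE] := @linear_exists R (LinHom A W) {ffun 'I_n -> W}
    (fun h => [ffun i => h (s i)]).
  by move=> a u v; apply/ffunP => i; rewrite !ffunE.
apply: (fin_gen_inj (i := f)) (fin_gen_ffun n fgW) => // g h.
rewrite !fE => /ffunP gh; apply: Hom_ext => x; have [u <-] := sA x.
rewrite !linear_sum; apply: eq_bigr => i _; rewrite !linearZ.
by have := gh i; rewrite !ffunE => ->.
Qed.

End HomFinGen.

(** * Ext into a module with an injective resolution *)

Section InjectiveResolution.
Local Open Scope ring_scope.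
Variables (R : comNzRingType) (W : lmodType R).
Variables (J : nat -> lmodType R) (e : {linear W -> J 0}).
Variable d : forall i, {linear J i -> J i.+1}.
Hypothesis J_inj : forall i, injective_module (J i).
Hypothesis e_inj : injective e.
Hypothesis exact_e : exact_at e (d 0).
Hypothesis exact_d : forall i, exact_at (d i) (d i.+1).
Implicit Types A B C K N : lmodType R.

Definition cocycle A i (f : LinHom A (J i)) := forall a, d i (f a) = 0.

(** The complex is Hom(A, J) without the term Hom(A, W), so in degree 0 the only coboundary is zero
    and Ext^0 is Hom(A, W). *)
Definition coboundary A i : LinHom A (J i) -> Prop :=
  match i with
  | 0 => fun f => forall a, f a = 0
  | j.+1 => fun f => exists g : {linear A -> J j}, forall a, f a = d j (g a)
  end.

(* Ext^i(A, W) = 0, computed with J. *)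
Definition ext_zero i A := forall f : LinHom A (J i), cocycle f -> coboundary f.

Lemma dd i x : d i.+1 (d i x) = 0.
Proof. exact: (exact_comp0 (@exact_d i)). Qed.

Lemma ext_zero_iso i A B (f : {linear A -> B}) :
  injective f -> surjective f -> ext_zero i A -> ext_zero i B.
Proof.
move=> f_inj f_surj A0 h hc.
have [|g gf] := @inj_factor R A B B f idfun f_inj; first by move=> b; apply: f_surj.
have {}gf b : f (g b) = b by apply: gf.
have := A0 (h \o f); have hfc : cocycle (h \o f : LinHom A (J i)) by move=> a; apply: hc.
move=> /(_ hfc); case: i h hc {A0 hfc} => [|i] h hc /= => [hf b|[u hu]].
  by rewrite -[b]gf hf.
by exists (u \o g) => b /=; rewrite -hu gf.
Qed.

Lemma ext_zero_trivial i A : zero_module A -> ext_zero i A.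
Proof.
move=> A0 f _; case: i f => [|i] f /=; last exists \0;
  by move=> a; rewrite (A0 a) !linear0.
Qed.

Lemma ext_zero_free i n : ext_zero i.+1 'rV[R]_n.
Proof.
move=> f fc; have [|g gf] := @free_lift R _ _ n (d i) f; last by exists g.
by move=> x; apply/exact_d/fc.
Qed.

Lemma ext_zero_ffun i n N : ext_zero i.+1 N -> ext_zero i.+1 {ffun 'I_n -> N}.
Proof.
move=> N0 f fc.
have /choice[g gE] : forall b, exists g : {linear N -> J i},
    forall x, f (single b x) = d i (g x).
  move=> b; have [|g gE] := N0 (f \o single b); last by exists g.
  by move=> x; apply: fc.
have [|h hE] := @linear_exists R {ffun 'I_n -> N} (J i)
    (fun x : {ffun 'I_n -> N} => \sum_b g b (x b)).
  move=> a u v; rewrite scaler_sumr -big_split /=; apply: eq_bigr => b _.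
  by rewrite !ffunE linearP.
exists h => x; rewrite hE -{1}[x]sum_single !linear_sum; apply: eq_bigr => b _.
exact: gE.
Qed.

Section LongExactSequence.
Variables (A B C : lmodType R) (f : {linear A -> B}) (p : {linear B -> C}).
Hypothesis ses : short_exact f p.

Lemma ses_extend i (g : {linear A -> J i}) :
  exists h : {linear B -> J i}, forall a, h (f a) = g a.
Proof. by case: ses => f_inj _ _; apply: J_inj. Qed.

Lemma ses_descend (D : lmodType R) (g : {linear B -> D}) : (forall a, g (f a) = 0) ->
  exists h : {linear C -> D}, forall b, h (p b) = g b.
Proof.
case: ses => _ ex ps gf; apply: surj_factor => // b /ex[a <-]; exact: gf.
Qed.

Lemma ses_comp0 a : p (f a) = 0.
Proof. by case: ses => _ ex _; apply: (exact_comp0 ex). Qed.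

(** A primitive on [A], extended to [B], corrects the cocycle into one that descends to [C]. *)
Lemma ext_zero_mid i : ext_zero i.+1 A -> ext_zero i.+1 C -> ext_zero i.+1 B.
Proof.
case: (ses) => _ _ ps A0 C0 g gc.
have [|h hE] := A0 (g \o f); first by move=> a; apply: gc.
have [h' h'E] := ses_extend h.
have [a|k kE] := @ses_descend _ (g \- (d i \o h')).
  by rewrite /= h'E -hE subrr.
have [c|l lE] := C0 k.
  have [b <-] := ps c; rewrite kE /= linearB dd subr0; exact: gc.
exists (h' \+ (l \o p)) => b /=.
by rewrite linearD -lE kE /= addrC subrK.
Qed.

(** Through the connecting map: the cocycle extends to a cochain on [B], whose differential descends
    to a cocycle on [C]. *)
Lemma ext_zero_sub i : ext_zero i.+1 B -> ext_zero i.+2 C -> ext_zero i.+1 A.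
Proof.
case: (ses) => _ _ ps B0 C0 g gc.
have [h hE] := ses_extend g.
have [a|k kE] := @ses_descend _ (d i.+1 \o h); first by rewrite /= hE; apply: gc.
have [c|l lE] := C0 k; first by have [b <-] := ps c; rewrite kE /= dd.
have [b|u uE] := B0 (h \- (l \o p)).
  by rewrite /= linearB -lE kE /= subrr.
exists (u \o f) => a /=.
by rewrite -uE /= ses_comp0 linear0 subr0 hE.
Qed.

(** A primitive on [B] of the pulled back cocycle restricts to a cocycle on [A]; once that is
    bounded, the primitive can be corrected to descend to [C]. *)
Lemma ext_zero_quo i : ext_zero i.+1 A -> ext_zero i.+2 B -> ext_zero i.+2 C.
Proof.
case: (ses) => _ _ ps A0 B0 g gc.
have [b|h hE] := B0 (g \o p); first exact: gc.
have [a|k kE] := A0 (h \o f); first by rewrite /= -hE /= ses_comp0 linear0.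
have [k' k'E] := ses_extend k.
have [a|l lE] := @ses_descend _ (h \- (d i \o k')).
  by rewrite /= k'E -kE subrr.
exists l => c; have [b <-] := ps c.
by rewrite lE /= linearB dd subr0 -hE.
Qed.

(** The obstruction lies in Ext^1(C, W): extend into [J 0], then subtract a map coming from [C] so
    that the values fall in the kernel of [d 0], which is [W]. *)
Lemma hom_extend (g : {linear A -> W}) : ext_zero 1 C ->
  exists h : {linear B -> W}, forall a, h (f a) = g a.
Proof.
case: (ses) => _ _ ps C0.
have [h hE] := ses_extend (e \o g).
have [a|k kE] := @ses_descend _ (d 0 \o h).
  by rewrite /= hE /=; apply: (exact_comp0 exact_e).
have [c|l lE] := C0 k; first by have [b <-] := ps c; rewrite kE /= dd.
have [b|u uE] := @inj_factor R _ _ _ e (h \- (l \o p)) e_inj.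
  by apply/exact_e; rewrite /= linearB -lE kE /= subrr.
exists u => a; apply: e_inj; rewrite uE /= ses_comp0 linear0 subr0.
exact: hE.
Qed.

End LongExactSequence.

Lemma submod_cocycle A i : submod (fun f : LinHom A (J i) => cocycle f).
Proof.
split=> [a|a f g fc gc b]; first exact: linear0.
rewrite [X in d i X](_ : _ = a *: f b + g b) //.
by rewrite linearP fc gc scaler0 addr0.
Qed.

Lemma submod_coboundary A i : submod (fun f : LinHom A (J i) => coboundary f).
Proof.
split=> [|a f g].
  by case: i => [|i] //=; exists \0 => a; rewrite linear0.
case: i f g => [f g fc gc b|i f g [u fu] [v gv]].
  by rewrite [LHS](_ : _ = a *: f b + g b) // fc gc scaler0 addr0.
exists ((a \*: u) \+ v) => b.
by rewrite [LHS](_ : _ = a *: f b + g b) // fu gv -linearP.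
Qed.

(** Finite generation of Ext^i(A, W), in the shape that [nakayama] takes. The terms of [J] are
    rarely finitely generated, so this does not come from the cochains. *)
Definition ext_fin_gen i A := exists n (s : 'I_n -> LinHom A (J i)),
  (forall k, cocycle (s k)) /\
  forall z : LinHom A (J i), cocycle z -> exists (a : 'I_n -> R) b,
    coboundary b /\ z = \sum_k a k *: s k + b.

Lemma ext_fin_gen0 A :
  noetherian R -> fin_gen W -> fin_gen A -> ext_fin_gen 0 A.
Proof.
move=> Rn fgW fgA; have /fin_genP[n [s sP]] := fin_gen_hom Rn fgA fgW.
exists n, (fun k => e \o s k); split=> [k a|z zc].
  exact: (exact_comp0 exact_e).
have [|w wE] := @inj_factor R _ _ _ e z e_inj; first by move=> a; apply/exact_e/zc.
have [u uw] := sP w; exists (u 0), 0; split=> //; rewrite addr0.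
apply: Hom_ext => a; rewrite hom_sumE -wE -uw hom_sumE linear_sum.
by apply: eq_bigr => k _; rewrite linearZ.
Qed.

(** The connecting map Ext^i(K, W) -> Ext^(i+1)(A, W) is onto because the middle module is free; the
    [c k] are the images of the generators. *)
Lemma ext_fin_genS n i K A (f : {linear K -> 'rV[R]_n})
    (p : {linear 'rV[R]_n -> A}) :
  short_exact f p -> ext_fin_gen i K -> ext_fin_gen i.+1 A.
Proof.
move=> ses [N [s [sc sP]]]; have [_ ex ps] := ses.
have /choice[H HE] k := ses_extend ses (s k).
have /choice[c cE] : forall k, exists c : {linear A -> J i.+1},
    forall b, c (p b) = d i (H k b).
  move=> k; have [a|c cE] := ses_descend ses (g := d i \o H k); last by exists c.
  by rewrite /= HE; apply: sc.
exists N, c; split=> [k a|z zc].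
  by have [b <-] := ps a; rewrite cE dd.
have [x|g gE] := @free_lift R _ _ n (d i) (z \o p).
  by apply/exact_d/zc.
have [|a [b [bb gfE]]] := sP (g \o f).
  by move=> x /=; rewrite gE /= (ses_comp0 ses) linear0.
(* A coboundary on [K] extends to a map killed by [d i]: in degree 0 it is zero, and otherwise its
   primitive extends. *)
have [b' [b'E db']] : exists b' : {linear 'rV[R]_n -> J i},
    (forall x, b' (f x) = b x) /\ forall x, d i (b' x) = 0.
  case: i b bb {s sc sP H HE c cE z zc g gE gfE} => [|i] b /=.
    by move=> b0; exists \0; split=> x; rewrite ?linear0 // b0.
  move=> [u bu]; have [U UE] := ses_extend ses u.
  by exists (d i \o U); split=> x /=; rewrite ?UE ?dd // bu.
have {}gfE x : g (f x) = \sum_k a k *: s k x + b x.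
  by rewrite -hom_sumE; exact: (congr1 (fun h : LinHom _ _ => h x) gfE).
(* What remains of [g] after subtracting these extensions vanishes on [K], so it descends to [A]. *)
have [|q qE] := @linear_exists R 'rV[R]_n (J i)
    (fun x => g x - \sum_k a k *: H k x - b' x).
  move=> r u v; rewrite !linearP.
  under eq_bigr => k _ do rewrite linearP scalerDr scalerA mulrC -scalerA.
  rewrite big_split /= -scaler_sumr !opprD !scalerDr !scalerN.
  by rewrite [X in X + _ = _]addrACA [LHS]addrACA.
have [x|g' g'E] := ses_descend ses (g := q).
  rewrite qE gfE b'E; under [X in _ - X - _]eq_bigr => k _ do rewrite HE.
  by rewrite addrAC addrK subrr.
exists a, (d i \o g'); split; first by exists g'.
apply: Hom_ext => x; have [y <-] := ps x.
rewrite [RHS](_ : _ = (\sum_k a k *: (c k : LinHom A (J i.+1)) :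
  LinHom A (J i.+1)) (p y) + d i (g' (p y))) //.
rewrite hom_sumE g'E qE !linearB db' subr0 gE /= linear_sum.
under [X in _ - X]eq_bigr => k _ do rewrite linearZ /= -cE.
by rewrite addrC subrK.
Qed.

Lemma ext_fin_genP i A :
  noetherian R -> fin_gen W -> fin_gen A -> ext_fin_gen i A.
Proof.
move=> Rn fgW; elim: i A => [|i IHi] A fgA; first exact: ext_fin_gen0.
have /fin_genP[n [s sA]] := fgA.
have [K [f ses]] := short_exact_ker sA.
apply: (ext_fin_genS ses); apply: IHi; have [f_inj _ _] := ses.
exact: fin_gen_inj f_inj (fin_gen_rV _ _).
Qed.

(* x maps the cocycles onto themselves, so Nakayama applies. *)
Lemma ext_zero_regular (m : R^o -> Prop) i A C (p : {linear A -> C}) x :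
    local_at m -> noetherian R -> fin_gen W -> fin_gen A -> m x ->
    (forall a : A, x *: a = 0 -> a = 0) -> surjective p ->
    (forall a, p a = 0 <-> exists b, a = x *: b) ->
  ext_zero i.+1 C -> ext_zero i A.
Proof.
move=> Rloc Rn fgW fgA mx x_reg ps pP C0 f fc.
have [n [s [sc sP]]] := ext_fin_genP i Rn fgW fgA.
apply: (nakayama Rloc (submod_cocycle A i) (submod_coboundary A i) sc sP) fc.
move=> {}f fc.
have [mul ses mulE] := short_exact_mul x_reg ps pP.
(* Extending [f] along multiplication by [x] gives x h = f. The differential of [h] descends to [C];
   subtracting a primitive [l] turns [h] into a cocycle [u], still with f = x u since [p] kills
   xA. *)
have [h hE] := ses_extend ses f.
have {}hE a : x *: h a = f a by rewrite -hE mulE linearZ.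
have [a|k kE] := ses_descend ses (g := d i \o h).
  by rewrite /= mulE !linearZ /= -linearZ hE; apply: fc.
have [c|l lE] := C0 k; first by have [b <-] := ps c; rewrite kE /= dd.
pose u : LinHom A (J i) := h \- (l \o p).
exists 1%N, (fun=> x), (fun=> u), 0; split=> //.
- by move=> _ b /=; rewrite linearB -lE kE /= subrr.
- exact: (submod0 (submod_coboundary A i)).
rewrite big_ord1 addr0; apply: Hom_ext => a.
rewrite [RHS](_ : _ = x *: (h a - l (p a))) //.
have pxa : p (x *: a) = 0 by apply/pP; exists a.
by rewrite scalerBr hE -!linearZ pxa !linear0 addr0.
Qed.

End InjectiveResolution.

(** * Depth *)

Section Socle.
Local Open Scope ring_scope.
Variables (R : comNzRingType) (m I : R^o -> Prop).
Hypotheses (Rn : noetherian R) (sm : submod m) (sI : submod I).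

Let idM a x : I x -> I (a * x). Proof. exact: (submodZ sI a (v := x)). Qed.

(* The colon ideal (I : z) is maximal among the proper ones. *)
Let maxcolon z := ~ I z /\ forall w, ~ I w ->
  (forall y, I (y * z) -> I (y * w)) -> forall y, I (y * w) -> I (y * z).

(** (I : z) is contained in the proper ideal (I : bz), hence equal to it by maximality. *)
Let maxcolon_prime z a b : maxcolon z -> I (a * b * z) -> ~ I (b * z) -> I (a * z).
Proof.
move=> [_ zmax] abz nbz; apply: (zmax _ nbz) => [y|]; last by rewrite mulrA.
by rewrite mulrCA; apply: idM.
Qed.

Let maxcolon_exists w : ~ I w ->
  exists2 z, maxcolon z & forall y, I (y * w) -> I (y * z).
Proof.
move=> nIw.
have scolon z : submod (fun y : R^o => I (y * z)).
  split=> [|a u v uz vz]; first by rewrite mul0r; apply: (submod0 sI).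
  by rewrite mulrDl -mulrA; apply: (submodD sI) => //; apply: idM.
pose P (K : R^o -> Prop) := exists z, [/\ ~ I z,
  forall y, K y <-> I (y * z) & forall y, I (y * w) -> K y].
have [|K [_ [z [nIz Kz wK]] Kmax]] := noetherian_max Rn (P := P) (scolon w).
  by exists w.
exists z => [|y /wK/Kz//]; split=> // w' nIw' zw' y yw'; apply/Kz.
apply: (Kmax _ (scolon w')) yw' => [|x /Kz/zw' //].
by exists w'; split=> // x /wK/Kz/zw'.
Qed.

(** Take the product of elements of the (I : z) outside (I : z0); the latter is prime. *)
Let separate (zs : seq R^o) z0 : maxcolon z0 ->
    (forall z, z \in zs -> exists c, I (c * z) /\ ~ I (c * z0)) ->
  exists c, (forall z, z \in zs -> I (c * z)) /\ ~ I (c * z0).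
Proof.
move=> z0max; elim: zs => [|z zs IHzs] zsP.
  by exists 1; split=> //; rewrite mul1r; case: z0max.
have [|c [czs ncz0]] := IHzs.
  by move=> x xzs; apply: zsP; rewrite in_cons xzs orbT.
have [c' [c'z nc'z0]] := zsP z (mem_head _ _).
exists (c * c'); split=> [x|ccz0]; last first.
  by apply: ncz0; apply: maxcolon_prime ccz0 nc'z0.
rewrite in_cons => /predU1P[-> | xzs]; first by rewrite -mulrA; apply: idM.
by rewrite [c * c']mulrC -mulrA; apply/idM/czs.
Qed.

(** Prime avoidance for the primes (I : z), none of which contains [m]. *)
Let avoid (zs : seq R^o) : (forall z, z \in zs -> maxcolon z) ->
    (forall z, ~ I z -> exists y, m y /\ ~ I (y * z)) ->
  exists y, m y /\ forall z, z \in zs -> ~ I (y * z).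
Proof.
move=> + nsoc; elim: zs => [|z0 zs IHzs] zsmax.
  by exists 0; split=> //; apply: (submod0 sm).
have [|y [my yzs]] := IHzs.
  by move=> x xzs; apply: zsmax; rewrite in_cons xzs orbT.
have z0max := zsmax z0 (mem_head _ _).
case: (pselect (I (y * z0))) => [yz0|nyz0]; last first.
  by exists y; split=> // z; rewrite in_cons => /predU1P[-> // | /yzs].
(* Here [y] avoids every prime except (I : z0). By maximality no other prime is contained in (I :
   z0), so some [c] lies in all the others but not in it; for [b] in [m] outside (I : z0), the
   element y + bc avoids them all. *)
have [|c [czs ncz0]] := @separate zs z0 z0max.
  move=> z zzs; apply: contrapT => nc; apply: (yzs z zzs).
  have [nIz zmax] : maxcolon z by apply: zsmax; rewrite in_cons zzs orbT.
  apply: (zmax z0) => //; first by case: z0max.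
  by move=> x xz; apply: contrapT => nxz0; apply: nc; exists x.
have [b [mb nbz0]] := nsoc z0 (proj1 z0max).
exists (y + b * c); split=> [|z].
  by apply: (submodD sm) => //; rewrite mulrC; apply: (submodZ sm c mb).
rewrite mulrDl in_cons => /predU1P[-> | zzs] Iz.
  apply: nbz0; apply: (maxcolon_prime z0max) ncz0.
  by rewrite -[X in I X](addKr (y * z0)) addrC; apply: (submodB sI).
apply: (yzs z zzs); rewrite -[X in I X](addrK (b * c * z)).
by apply: (submodB sI) => //; rewrite -mulrA; apply/idM/czs.
Qed.

(** The zero divisors of R/I lie in the primes of [maxcolon]. If no such prime contained [m], an
    element of [m] avoiding finitely many of them would avoid them all. *)
Lemma socle_or_regular : ~ I 1 ->
    (forall y, m y -> exists w, ~ I w /\ I (y * w)) ->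
  exists z, ~ I z /\ forall y, m y -> I (y * z).
Proof.
move=> nI1 zd; apply: contrapT => nosoc.
have {nosoc} nsoc z : ~ I z -> exists y, m y /\ ~ I (y * z).
  move=> nIz; apply: contrapT => ny; apply: nosoc; exists z; split=> // y my.
  by apply: contrapT => nyz; apply: ny; exists y.
pose fix span (zs : seq R^o) (x : R^o) {struct zs} : Prop := if zs is z :: zs' then
  exists (a : R) (y : R), span zs' y /\ x = a * z + y else x = 0.
have sspan zs : submod (span zs).
  elim: zs => [|z zs IHzs]; split=> [|a u v]; rewrite /=.
  - by [].
  - by move=> -> ->; rewrite scaler0 addr0.
  - by exists 0, 0; split; [apply: (submod0 IHzs) | rewrite mul0r addr0].
  move=> [b [y [sy ->]]] [b' [y' [sy' ->]]]; exists (a * b + b'), (a * y + y').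
  split; first by apply: (submodD IHzs) sy'; apply: (submodZ IHzs a sy).
  by rewrite [_ *: _]mulrDr mulrDl -!mulrA addrACA.
have span_kill zs c : (forall z, z \in zs -> I (c * z)) ->
    forall x, span zs x -> I (c * x).
  elim: zs => [|z zs IHzs] czs x /=; first by move=> ->; rewrite mulr0; apply: (submod0 sI).
  move=> [a [y [sy ->]]]; rewrite mulrDr mulrCA; apply: (submodD sI).
    by apply/idM/czs/mem_head.
  by apply: IHzs => // z' z'zs; apply: czs; rewrite in_cons z'zs orbT.
(* A list [zs] with maximal span contains in its span every [z] satisfying [maxcolon]. Hence each (I
   : z) contains one of the listed primes: otherwise some [c] would kill [zs] modulo [I], but not
   [z]. *)
pose P (K : R^o -> Prop) := exists2 zs, (forall z, z \in zs -> maxcolon z)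
  & forall x, K x <-> span zs x.
have [|K [_ [zs zsmax Kzs] Kmax]] := noetherian_max Rn (P := P) (sspan [::]).
  by exists [::].
have inspan z : maxcolon z -> span zs z.
  move=> zmax; apply/Kzs; apply: (Kmax _ (sspan (z :: zs))).
  - by exists (z :: zs) => // x; rewrite in_cons => /predU1P[-> // | /zsmax].
  - by move=> x /Kzs sx; exists 0, x; rewrite mul0r add0r.
  by exists 1, 0; rewrite mul1r addr0; split=> //; apply: (submod0 (sspan zs)).
have [y [my yzs]] := avoid zsmax nsoc.
have [w [nIw yw]] := zd y my.
have [z zmax /(_ y yw) yz] := maxcolon_exists nIw.
have [[z' [z'zs zz']]|nz'] :=
    pselect (exists z', z' \in zs /\ forall x, I (x * z') -> I (x * z)).
  apply: (yzs z' z'zs); have [_ z'max] := zsmax _ z'zs.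
  exact: (z'max z (proj1 zmax) zz' y yz).
have [|c [czs ncz]] := @separate zs z zmax.
  move=> z' z'zs; apply: contrapT => nc; apply: nz'; exists z'; split=> // x xz'.
  by apply: contrapT => nxz; apply: nc; exists x.
exact/ncz/(span_kill _ _ czs)/inspan.
Qed.

End Socle.

(** * Successive quotients by a regular sequence *)

Section RegularSequences.
Local Open Scope ring_scope.
Variable R : comNzRingType.
Implicit Types M Q : lmodType R.

(** Families indexed by [nat] serve [s] and [rcons s x] alike, without casts. *)
Lemma in_smul_natP M (s : seq R) (v : M) : in_smul s v <->
  exists u : nat -> M, v = \sum_(i < size s) s`_i *: u i.
Proof.
split=> [[u ->]|[u ->]]; last by exists u.
exists (fun i => if insub i is Some j then u j else 0).
by apply: eq_bigr => i _; rewrite valK.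
Qed.

Lemma in_smul_nil M (v : M) : in_smul [::] v <-> v = 0.
Proof.
rewrite in_smul_natP; split=> [[u ->]|->]; first by rewrite big_ord0.
by exists (fun=> 0); rewrite big_ord0.
Qed.

Lemma in_smul_rcons M (s : seq R) x (v : M) : in_smul (rcons s x) v <->
  exists w u, in_smul s w /\ v = w + x *: u.
Proof.
have sumE (u : nat -> M) : \sum_(i < size (rcons s x)) (rcons s x)`_i *: u i =
    \sum_(i < size s) s`_i *: u i + x *: u (size s).
  rewrite size_rcons big_ord_recr /= nth_rcons ltnn eqxx; congr (_ + _).
  by apply: eq_bigr => i _; rewrite nth_rcons ltn_ord.
rewrite in_smul_natP; split=> [[u ->]|[w [y [/in_smul_natP[u ->] ->]]]].
  by rewrite sumE; exists (\sum_(i < size s) s`_i *: u i), (u (size s)); split;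
    first by apply/in_smul_natP; exists u.
pose u' i := if i == size s then y else u i.
exists u'; rewrite (sumE u') /u' eqxx.
by congr (_ + _); apply: eq_bigr => i _; rewrite ltn_eqF.
Qed.

Lemma submod_in_smul M (s : seq R) : submod (fun v : M => in_smul s v).
Proof.
split=> [|a _ _ [u ->] [v ->]].
  by exists (fun=> 0); rewrite big1 // => i _; rewrite scaler0.
exists (fun i => a *: u i + v i); rewrite scaler_sumr -big_split /=.
by apply: eq_bigr => i _; rewrite scalerDr !scalerA mulrC.
Qed.

Definition is_quotient M (s : seq R) Q (q : {linear M -> Q}) :=
  surjective q /\ forall v, q v = 0 <-> in_smul s v.

Lemma is_quotient_exists M s :
  exists (Q : lmodType R) (q : {linear M -> Q}), is_quotient s q.
Proof. exact: (quotient_exists (submod_in_smul M s)). Qed.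

(** Presents [Q'] as Q/xQ for a nonzerodivisor x on [Q], as required by [short_exact_mul] and
    [ext_zero_regular]. *)
Lemma is_quotient_next M (s : seq R) i Q Q' (q : {linear M -> Q})
    (q' : {linear M -> Q'}) :
    regular_sequence M s -> (i < size s)%N ->
    is_quotient (take i s) q -> is_quotient (take i.+1 s) q' ->
  exists p : {linear Q -> Q'},
    [/\ surjective p, forall a : Q, s`_i *: a = 0 -> a = 0
      & forall a, p a = 0 <-> exists b, a = s`_i *: b].
Proof.
move=> [s_reg _] i_s [qs qP] [qs' qP'].
have stake v : in_smul (take i.+1 s) v <->
    exists w u, in_smul (take i s) w /\ v = w + s`_i *: u.
  by rewrite (take_nth 0) // in_smul_rcons.
have [|p pE] := @surj_factor R _ _ _ q q' qs.
  move=> b /qP bs; apply/qP'/stake; exists b, 0; split=> //.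
  by rewrite scaler0 addr0.
exists p; split=> [c|a|a].
- by have [v <-] := qs' c; exists (q v).
- by have [v <-] := qs a; rewrite -linearZ_LR => /qP/(s_reg _ i_s)/qP.
have [v <-] := qs a; rewrite pE; split=> [/qP'/stake[w [u [/qP qw ->]]]|[b]].
  by exists (q u); rewrite linearD qw add0r linearZ_LR.
have [u <-] := qs b; rewrite -linearZ_LR => vu; apply/qP'/stake.
exists (v - s`_i *: u), u; split; last by rewrite subrK.
by apply/qP; rewrite linearB vu subrr.
Qed.

End RegularSequences.

(** * Vanishing of Ext into a module of finite injective dimension *)

Section BassBound.
Local Open Scope ring_scope.
Variables (R : comNzRingType) (W : lmodType R).
Variables (J : nat -> lmodType R) (e : {linear W -> J 0}).
Variable d : forall i, {linear J i -> J i.+1}.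
Hypothesis J_inj : forall i, injective_module (J i).
Hypothesis e_inj : injective e.
Hypothesis exact_e : exact_at e (d 0).
Hypothesis exact_d : forall i, exact_at (d i) (d i.+1).
Variables (idim : nat) (m : idealr R).
Hypothesis J0 : forall i, (idim < i)%N -> zero_module (J i).
Hypothesis Rn : noetherian R.
Hypothesis Rloc : local_at (fun x => x \in m).
Hypothesis fgW : fin_gen W.
Implicit Types A L N Q : lmodType R.

(** The quotient by [i] regular elements has projective dimension at most [i]: each element raises
    the vanishing degree by one, starting from [R] itself. *)
Lemma ext_zero_quotient (s : seq R) (i r : nat) Q (q : {linear R^o -> Q}) :
    regular_sequence R^o s -> (i <= size s)%N -> is_quotient (take i s) q ->
  (i < r)%N -> ext_zero d r Q.
Proof.
move=> s_reg; elim: i r Q q => [|i IHi] r Q q i_s [qs qP] ir.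
  case: r ir => // r _; have [|f fE] := @linear_exists R 'rV[R]_1 Q
      (fun v => q (v 0 0 : R^o)).
    by move=> a u v; rewrite !mxE -linearP.
  apply: (ext_zero_iso (f := f) _ _ (@ext_zero_free _ _ _ exact_d r 1)).
    apply: linear_inj_ker => v; rewrite fE => /qP; rewrite take0.
    by move=> /in_smul_nil v0; apply/rowP => j; rewrite (ord1 j) v0 mxE.
  by move=> x; have [a <-] := qs x; exists (const_mx a); rewrite fE mxE.
have [A [q' q'P]] := is_quotient_exists R^o (take i s).
have [p [ps x_reg pP]] := is_quotient_next s_reg i_s q'P (conj qs qP).
have [f ses _] := short_exact_mul x_reg ps pP.
case: r ir => // -[|r] // ir.
by apply: (ext_zero_quo J_inj exact_d ses); apply: (IHi _ _ _ (ltnW i_s) q'P);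
  rewrite // ltnW.
Qed.

Lemma ext_zero_above_idim r A : (idim < r)%N -> ext_zero d r A.
Proof.
case: r => // r /J0 Jr0 f _; exists \0 => a; rewrite linear0; exact: Jr0.
Qed.

Lemma local_notin x : x \notin m -> exists y : R, y * x = 1.
Proof. by case: Rloc => _ _ mu /negP; apply: mu. Qed.

(** As [s] has the maximal length, appending any [y] in [m] destroys regularity, so [y] is a zero
    divisor modulo [s]. *)
Lemma socle_exists (s : seq R) :
    depth m R^o (size s) -> {in s, forall x, x \in m} ->
    regular_sequence R^o s ->
  exists z : R^o, ~ in_smul s z /\ forall y : R, y \in m -> in_smul s (y * z : R^o).
Proof.
move=> [_ s_max] sm s_reg; have [mm nm1 _] := Rloc.
have sI := submod_in_smul R^o s.
apply: (socle_or_regular Rn mm sI).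
  move=> s1; have [_ [v]] := s_reg; apply.
  by have := submodZ sI (v : R) s1; rewrite [_ *: _]mulr1.
move=> y my; apply: contrapT => y_reg.
have : (size (rcons s y) <= size s)%N; last by rewrite size_rcons ltnn.
apply: s_max => [x|].
  by rewrite mem_rcons in_cons => /predU1P[-> // | /sm].
split=> [i|]; last first.
  exists 1 => /in_smul_rcons[w [u [/in_smul_natP[v ->] s1]]]; apply: nm1.
  rewrite s1; apply: (submodD mm).
    elim/big_ind: _ => [|a b|i _]; first exact: (submod0 mm).
      exact: (submodD mm).
    by rewrite [_ *: _]mulrC idealMr // sm // mem_nth.
  by rewrite [_ *: _]mulrC idealMr.
rewrite size_rcons ltnS leq_eqVlt => /predU1P[-> | i_s] u.
  rewrite -cats1 take_size_cat // nth_cat ltnn subnn /= => yu.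
  by apply: contrapT => nu; apply: y_reg; exists u.
rewrite -cats1 takel_cat ?(ltnW i_s) // nth_cat i_s.
by have [+ _] := s_reg; apply.
Qed.

(** Noetherian induction on the annihilator [I] of the cyclic module [L], according to whether [I]
    is not prime, prime without containing [m], or equal to [m]. *)
Lemma ext_zero_cyclic r Q (q0 : Q) :
    (forall L, fin_gen L -> ext_zero d r.+2 L) -> fin_gen Q -> 
    ext_zero d r.+1 Q -> q0 != 0 -> (forall y : R, y \in m -> y *: q0 = 0) ->
  forall I : R^o -> Prop, submod I -> forall L (c : L),
    (forall v, exists a : R, v = a *: c) -> (forall a, I a <-> a *: c = 0) ->
  ext_zero d r.+1 L.
Proof.
move=> extS fgQ Q0 q00 mq0; have [mm nm1 _] := Rloc.
apply: (noetherian_ind Rn) => I sI IH L c cL IE.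
have fgL : fin_gen L.
  have [h hE] := scale_map c; apply: (fin_gen_surj (p := h)) (fin_gen_R R).
  by move=> v; have [a ->] := cL v; exists a; rewrite hE.
case: (pselect (I 1)) => [I1|nI1].
  apply: ext_zero_trivial => v; have [a ->] := cL v; apply/IE.
  by have := submodZ sI (a : R) I1; rewrite [_ *: _]mulr1.
case: (pselect (exists a b : R, [/\ ~ I a, ~ I b & I (a * b)])) => [|I_prime].
  move=> [a [b [nIa nIb Iab]]].
  (* [L] is an extension of cyclic modules: the annihilator of the submodule generated by ac
     contains [b], and that of the quotient contains [a]. *)
  have [h hE] := scale_map (a *: c).
  have [A [i [i_inj iP]]] := submodule_exists (submod_im h).
  have [C [p ses]] := short_exact_coker i_inj; have [_ ex ps] := ses.
  have [cA cAE] : exists x, i x = a *: c.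
    by apply/iP; exists 1; rewrite hE scale1r.
  have [A' A'E] := scale_map cA; have [C' C'E] := scale_map (p c).
  apply: (ext_zero_mid J_inj exact_d ses).
    apply: (IH _ (submod_ker A') _ _ A cA).
    - by move=> x /IE cx; apply: i_inj; rewrite A'E linearZ_LR cAE scalerA mulrC
        -scalerA cx scaler0 linear0.
    - exists b; split=> //; apply: i_inj; rewrite A'E linearZ_LR cAE scalerA.
      by rewrite linear0 mulrC; apply/IE.
    - move=> v; have /iP[x hx] : exists s, i s = i v by exists v.
      by exists x; apply: i_inj; rewrite linearZ_LR cAE -hE.
    by move=> x; rewrite A'E.
  apply: (IH _ (submod_ker C') _ _ C (p c)).
  - by move=> x /IE cx; rewrite C'E -linearZ_LR cx linear0.
  - exists a; split=> //; rewrite C'E -linearZ_LR; apply/ex.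
    by exists cA.
  - move=> v; have [l <-] := ps v; have [x ->] := cL l; exists x.
    by rewrite linearZ_LR.
  by move=> x; rewrite C'E.
case: (pselect (exists x, x \in m /\ ~ I x)) => [[x [mx nIx]]|mI].
  (* As [I] is prime, [x] is a nonzerodivisor on [L], and Ext of L/xL vanishes one degree higher. *)
  have x_reg (v : L) : x *: v = 0 -> v = 0.
    have [a ->] := cL v; rewrite scalerA => /IE Ixa; apply/IE.
    by apply: contrapT => nIa; apply: I_prime; exists x, a.
  have sx : submod (fun v : L => exists b, v = x *: b).
    split=> [|a u v [b ->] [b' ->]]; first by exists 0; rewrite scaler0.
    by exists (a *: b + b'); rewrite scalerDr !scalerA mulrC.
  have [C [p [ps pP]]] := quotient_exists sx.
  apply: (ext_zero_regular J_inj e_inj exact_e exact_d Rloc Rn fgW fgL mx x_reg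
    ps pP).
  exact/extS/(fin_gen_surj ps).
(* Now [L] is the residue field and embeds in [Q] by sending [c] to the socle element [q0]. *)
have [h hE] := scale_map c; have [g gE] := scale_map q0.
have hs : surjective h by move=> v; have [a ->] := cL v; exists a; rewrite hE.
have [b|f fE] := @surj_factor R _ _ _ h g hs.
  rewrite hE gE => /IE Ib; apply: mq0; apply: contrapT => /negP/local_notin[y yb].
  by apply: nI1; rewrite -yb; apply: (submodZ sI y Ib).
have f_inj : injective f.
  apply: linear_inj_ker => v; have [a <-] := hs v; rewrite fE gE hE => aq0.
  apply/IE; apply: contrapT => nIa; case: (boolP (a \in m)) => [am|].
    by apply: mI; exists a.
  move=> /local_notin[y ya]; move/eqP: q00; apply.
  by rewrite -[q0]scale1r -ya -scalerA aq0 scaler0.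
have [C [p ses]] := short_exact_coker f_inj.
apply: (ext_zero_sub J_inj exact_d ses Q0).
by apply/extS/(fin_gen_surj (p := p)) => //; case: ses.
Qed.

(* The argument of Bass' theorem that a finitely generated module of finite
   injective dimension has injective dimension depth R. *)
Lemma ext_zero_above_depth t r L :
  depth m R^o t -> (t < r)%N -> fin_gen L -> ext_zero d r L.
Proof.
move=> dR tr.
have [[s [sm s_reg st]] _] := dR; rewrite -st in dR tr.
have {st} [Q [q qP]] := is_quotient_exists R^o s; have [qs q0P] := qP.
have [z [nz mz]] := socle_exists dR sm s_reg.
(* Descending induction on [r], from degrees above [idim] where the resolution is zero. *)
suff ext k : (idim < r + k)%N -> forall L, fin_gen L -> ext_zero d r L.
  by apply: (ext idim.+1); rewrite addnS ltnS leq_addl.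
elim: k r tr {L} => [|k IHk] r tr rk L fgL.
  by rewrite addn0 in rk; apply: ext_zero_above_idim.
case: r tr rk => // r tr rk.
have extS : forall L, fin_gen L -> ext_zero d r.+2 L.
  by apply: IHk; [apply: ltnW | rewrite addSnnS].
have Q0 : ext_zero d r.+1 Q.
  by apply: (ext_zero_quotient (q := q) s_reg (leqnn _) _ tr); rewrite take_size.
have qz0 : q z != 0 by apply/eqP => /q0P.
have mqz y : y \in m -> y *: q z = 0.
  by move=> my; rewrite -linearZ_LR; apply/q0P/mz.
have cyc := ext_zero_cyclic extS (fin_gen_surj qs (fin_gen_R R)) Q0 qz0 mqz.
have /fin_genP[n [u uL]] := fgL.
(* Splitting off the submodule generated by the first generator reduces to cyclic modules. *)
elim: n L u uL {fgL} => [|n IHn] L u uL.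
  by apply: ext_zero_trivial => v; have [w <-] := uL v; rewrite /comb big_ord0.
have [h hE] := scale_map (u ord0).
have [A [i [i_inj iP]]] := submodule_exists (submod_im h).
have [C [p ses]] := short_exact_coker i_inj; have [_ ex ps] := ses.
have [c cE] : exists x, i x = u ord0.
  by apply/iP; exists 1; rewrite hE scale1r.
apply: (ext_zero_mid J_inj exact_d ses).
  have [A' A'E] := scale_map c; apply: (cyc _ (submod_ker A') _ c) => [v|a].
    have /iP[x hx] : exists s, i s = i v by exists v.
    by exists x; apply: i_inj; rewrite linearZ_LR cE -hE.
  by rewrite A'E.
apply: (IHn _ (fun j => p (u (lift ord0 j)))) => v.
have [l <-] := ps v; have [w <-] := uL l; exists (\row_j w 0 (lift ord0 j)).
rewrite comb_row linear_sum big_ord_recl linearZ_LR -cE (exact_comp0 ex) scaler0 add0r.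
by apply: eq_bigr => j _; rewrite linearZ_LR.
Qed.

(** Start from the quotient of [N] by the whole sequence, whose length is depth R, where the bound
    of Bass applies. Each removed element lowers the vanishing degree by one. *)
Lemma ext_zero_max_depth N r : fin_gen N ->
    (exists t, depth m R^o t /\ depth m N t) -> (0 < r)%N -> ext_zero d r N.
Proof.
move=> fgN [t [dR [[s [sm s_reg st]] _]]].
suff ext k i Q (q : {linear N -> Q}) : (i + k = size s)%N ->
    is_quotient (take i s) q -> forall r, (i < r)%N -> ext_zero d r Q.
  apply: (ext (size s) 0%N N idfun) => //; split=> [x|v]; first by exists x.
  by rewrite take0 in_smul_nil.
elim: k i Q q => [|k IHk] i Q q ik [qs qP] j ij.
  apply: (ext_zero_above_depth dR); first by rewrite -st -ik addn0.
  exact: fin_gen_surj qs fgN.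
have i_s : (i < size s)%N by rewrite -ik -addSnnS leq_addr.
have [Q' [q' q'P]] := is_quotient_exists N (take i.+1 s).
have [p [ps x_reg pP]] := is_quotient_next s_reg i_s (conj qs qP) q'P.
apply: (ext_zero_regular J_inj e_inj exact_e exact_d Rloc Rn fgW _ _ x_reg ps pP).
- exact: fin_gen_surj qs fgN.
- by apply/sm/mem_nth.
by apply: (IHk i.+1 _ q') => //; rewrite addSnnS.
Qed.

(** * Tor of the dual of [N] as homology of a dual complex *)

Section TorDual.
Variables (M N : lmodType R) (F : free_resolution M).
Hypothesis N0 : forall i, ext_zero d i.+1 N.
Hypothesis MN0 : forall i, zero_module (Ext N F i.+1).

Implicit Types Z : lmodType R.

Let D i : {linear {ffun 'I_(rk F i) -> N} -> {ffun 'I_(rk F i.+1) -> N}} :=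
  mxact N (diff F i).

Let DD i x : D i.+1 (D i x) = 0.
Proof.
have dd0 : diff F i.+1 *m diff F i = 0.
  apply/row_matrixP => j; rewrite row_mul row0.
  by apply/(exact_diff (f := F)); exists (delta_mx 0 j); rewrite /= -rowE.
apply/ffunP => a; rewrite !ffunE.
under eq_bigr => b _ do rewrite ffunE scaler_sumr.
rewrite exchange_big big1 //= => c _.
under eq_bigr => b _ do rewrite scalerA.
rewrite -scaler_suml; move/matrixP: dd0 => /(_ a c); rewrite !mxE => ->.
by rewrite scale0r.
Qed.

Let D_exact i x : D i.+1 x = 0 -> exists u, D i u = x.
Proof. exact: (proj1 (homology_eq0 (D i) (D i.+1)) (@MN0 i)). Qed.

Let cycles i Z (f : {linear Z -> {ffun 'I_(rk F i) -> N}}) :=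
  injective f /\ forall v, D i v = 0 <-> exists z, f z = v.

Let cycles_exists i : exists (Z : lmodType R) f, @cycles i Z f.
Proof. exact: submodule_exists (submod_ker (D i)). Qed.

Let cycles_ses i Z Z' f f' : @cycles i Z f -> @cycles i.+1 Z' f' ->
  exists2 p : {linear {ffun 'I_(rk F i) -> N} -> Z'},
    short_exact f p & forall x, f' (p x) = D i x.
Proof.
move=> [f_inj fP] [f'_inj f'P].
have [x|p pE] := @inj_factor R _ _ _ f' (D i) f'_inj.
  by apply/f'P/DD.
exists p => //; split=> // [x|z].
  split=> [px|/fP Dx]; first by apply/fP; rewrite -pE px linear0.
  by apply: f'_inj; rewrite pE linear0.
have [x xz] := D_exact (proj2 (f'P (f' z)) (ex_intro _ z erefl)).
by exists x; apply: f'_inj; rewrite pE.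
Qed.

Let cycles_ext1 i Z f : @cycles i Z f -> ext_zero d 1 Z.
Proof.
(* Each shift raises both the Ext degree and the index of the cycles; [k] bounds the number of
   shifts needed to pass [idim]. *)
suff ext k l : (idim < l.+1 + k)%N -> forall i Z f, @cycles i Z f -> ext_zero d l.+1 Z.
  by apply: (ext idim); rewrite addSn ltnS.
elim: k l => [|k IHk] l lk {}i {}Z {}f fP.
  by apply: ext_zero_above_idim; rewrite addn0 in lk.
have [Z' [f' f'P]] := cycles_exists i.+1.
have [p ses _] := cycles_ses fP f'P.
apply: (ext_zero_sub J_inj exact_d ses); first exact: ext_zero_ffun.
by apply: IHk f'P; rewrite addSnnS.
Qed.

(* Tor(Hom(N, W), M) is the homology of the W-dual of the complex Hom(F, N),
   which stays exact because its cycles have no Ext^1 into W. *)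
Lemma tor_dual_zero i : zero_module (Tor (LinHom N W) F i.+1).
Proof.
apply/homology_eq0 => y y0.
(* A chain [y] is a family of maps from [N] to [W], that is, one map [phi] on a power of [N]; being
   a cycle means that [phi] vanishes on the image of [D i]. *)
have [|phi phiE] := @linear_exists R {ffun 'I_(rk F i.+1) -> N} W
    (fun x => \sum_b y b (x b)).
  move=> a u v; rewrite scaler_sumr -big_split /=; apply: eq_bigr => b _.
  by rewrite !ffunE linearP.
have phiD x : phi (D i x) = 0.
  rewrite phiE; under eq_bigr => b _ do rewrite ffunE linear_sum.
  rewrite exchange_big big1 //= => a _.
  have /ffunP/(_ a) := y0; rewrite !ffunE => /(congr1 (fun h : LinHom N W => h (x a))).
  rewrite hom_sumE => y0a; rewrite -[RHS]y0a.
  by apply: eq_bigr => b _; rewrite linearZ_LR mxE.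
have [Z1 [f1 f1P]] := cycles_exists i.+1.
have [Z2 [f2 f2P]] := cycles_exists i.+2.
have [Z3 [f3 f3P]] := cycles_exists i.+3.
have [p ses pE] := cycles_ses f1P f2P; have [p' ses' _] := cycles_ses f2P f3P.
(* So [phi] factors through the next cycles as [psi], which extends to the next power of [N] because
   Ext^1 of the third cycles vanishes. The components of the extension [chi] form a chain with
   boundary [y]. *)
have [z|psi psiE] := ses_descend ses (g := phi).
  have [_ f1D] := f1P.
  have [x <-] := D_exact (proj2 (f1D (f1 z)) (ex_intro _ z erefl)); exact: phiD.
have [chi chiE] := hom_extend J_inj e_inj exact_e exact_d ses' psi (cycles_ext1 f3P).
exists [ffun a => (chi \o single a : LinHom N W)].
apply/ffunP => b; rewrite ffunE; apply: Hom_ext => x; rewrite hom_sumE.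
transitivity (phi (single b x)); last first.
  rewrite phiE (bigD1 b) //= ffunE eqxx big1 ?addr0 // => a ab.
  by rewrite ffunE (negPf ab) linear0.
rewrite -psiE -chiE pE -[D _ _]sum_single linear_sum; apply: eq_bigr => a _.
rewrite !mxE ffunE /= -linearZ_LR -linearZ_LR; congr (chi (single a _)).
rewrite ffunE (bigD1 b) //= ffunE eqxx big1 ?addr0 // => c cb.
by rewrite ffunE (negPf cb) scaler0.
Qed.

End TorDual.

End BassBound.

(** * Finite projective dimension *)

Section ProjectiveDimension.
Local Open Scope ring_scope.
Variable R : comNzRingType.
Implicit Types A B K L P U V : lmodType R.

Lemma projective_rV n : projective 'rV[R]_n.
Proof. by move=> U V g f gs; apply: free_lift => x; apply: gs. Qed.

Lemma short_exact_split A B P (i : {linear A -> B}) (p : {linear B -> P}) :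
    projective P -> short_exact i p ->
  exists (s : {linear P -> B}) (r : {linear B -> A}),
    [/\ forall y, p (s y) = y, forall x, r (i x) = x
      & forall b, b = i (r b) + s (p b)].
Proof.
move=> Pproj [i_inj ex ps]; have [s sE] := Pproj _ _ p idfun ps.
have [b|r rE] := @inj_factor R _ _ _ i (idfun \- (s \o p)) i_inj.
  by apply/ex; rewrite /= linearB sE subrr.
exists s, r; split=> [//|x|b]; last by rewrite rE subrK.
by apply: i_inj; rewrite rE /= (exact_comp0 ex) linear0 subr0.
Qed.

Lemma projective_extension A B P (i : {linear A -> B}) (p : {linear B -> P}) :
  projective A -> projective P -> short_exact i p -> projective B.
Proof.
move=> Aproj Pproj ses U V g f gs.
have [s [r [ps ri bE]]] := short_exact_split Pproj ses.
have [hA hAE] := Aproj _ _ g (f \o i) gs; have [hP hPE] := Pproj _ _ g (f \o s) gs.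
exists ((hA \o r) \+ (hP \o p)) => b.
by rewrite [in RHS](bE b) /= !linearD hAE hPE.
Qed.

Lemma projective_retract A B (i : {linear A -> B}) (r : {linear B -> A}) :
  (forall x, r (i x) = x) -> projective B -> projective A.
Proof.
move=> ri Bproj U V g f gs; have [h hE] := Bproj _ _ g (f \o r) gs.
by exists (h \o i) => x; rewrite /= hE /= ri.
Qed.

(** Recursion on the first syzygy, unlike [pd_le]: inductions peel off one short exact sequence at a
    time. *)
Fixpoint pdim_le n L := if n is n'.+1 then
    exists P K (i : {linear K -> P}) (p : {linear P -> L}),
      [/\ projective P, short_exact i p & pdim_le n' K]
  else projective L.

(** By splitting, a cover of [A] by [Q] gives a cover of [B] by Q x P with the same kernel. *)
Lemma pdim_le_extension n A B P (i : {linear A -> B}) (p : {linear B -> P}) :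
  projective P -> short_exact i p -> pdim_le n A -> pdim_le n B.
Proof.
move=> Pproj ses; case: n => [|n] /=.
  by move=> Aproj; apply: projective_extension ses.
move=> [Q [K [j [q [Qproj [j_inj exj qs] Kn]]]]].
have [i_inj ex _] := ses; have [s [r [ps ri bE]]] := short_exact_split Pproj ses.
have [|inQ inQE] := @linear_exists R Q (Q * P)%type (fun x => (x, 0)).
  by move=> a u v; congr (_, _); rewrite /= scaler0 addr0.
have [//|prP prPE] := @linear_exists R (Q * P)%type P snd.
have [|t tE] := @linear_exists R (Q * P)%type B (fun x => i (q x.1) + s x.2).
  by move=> a u v; rewrite !linearP scalerDr addrACA.
exists (Q * P)%type, K, (inQ \o j), t; split=> //.
  apply: (projective_extension (i := inQ) (p := prP)) => //; split.
  - by move=> x y; rewrite !inQE => -[].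
  - move=> [x y]; rewrite prPE; split=> [/= ->|[u]]; first by exists x; rewrite inQE.
    by rewrite inQE => -[_ <-].
  by move=> y; exists (0, y); rewrite prPE.
split=> [x y|[x y]|b].
- by rewrite /= !inQE => -[/j_inj].
- rewrite tE /=; split=> [xy|[k]]; last first.
    by rewrite inQE => -[<- <-]; rewrite (exact_comp0 exj) !linear0 addr0.
  have y0 : y = 0.
    by move/(congr1 p): xy; rewrite linearD (exact_comp0 ex) ps add0r linear0.
  have /exj[k kx] : q x = 0.
    by apply: i_inj; rewrite linear0 -xy y0 linear0 addr0.
  by exists k; rewrite inQE kx y0.
have [x xE] := qs (r b); exists (x, p b).
by rewrite tE /= xE -bE.
Qed.

(** Composing a cover of [B] with the retraction onto [A] gives a cover of [A] whose kernel is an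
    extension of [P] by the old kernel. *)
Lemma pdim_le_kernel n A B P (i : {linear A -> B}) (p : {linear B -> P}) :
  projective P -> short_exact i p -> pdim_le n B -> pdim_le n A.
Proof.
move=> Pproj ses; have [s [r [ps ri bE]]] := short_exact_split Pproj ses.
have [_ ex _] := ses; case: n => [|n] /=; first exact: projective_retract ri.
move=> [Q [K [j [q [Qproj [j_inj exj qs] Kn]]]]].
have rqs : surjective (r \o q).
  by move=> a; have [x xa] := qs (i a); exists x; rewrite /= xa ri.
have [K' [j' ses']] := short_exact_ker rqs; have [j'_inj exj' _] := ses'.
exists Q, K', j', (r \o q); split=> //.
have [k|t tE] := @inj_factor R _ _ _ j' j j'_inj.
  by apply/exj'; rewrite /= (exact_comp0 exj) linear0.
apply: (pdim_le_extension (i := t) (p := p \o q \o j')) Kn => //; split.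
- by move=> x y xy; apply: j_inj; rewrite -!tE xy.
- move=> x; split=> [/= pqx|[k <-]]; last first.
    by rewrite /= tE (exact_comp0 exj) linear0.
  have rqx : r (q (j' x)) = 0 by apply: (exact_comp0 exj').
  have /exj[k kx] : q (j' x) = 0 by rewrite [LHS]bE rqx pqx !linear0 addr0.
  by exists k; apply: j'_inj; rewrite tE.
move=> y; have [x xE] := qs (s y).
have /exj'[z zx] : (r \o q) x = 0.
  have : i (r (s y)) = 0.
    by apply: (addIr (s y)); rewrite add0r -[in X in _ + s X](ps y) -bE.
  by rewrite /= xE => iry; have [i_inj _ _] := ses; apply: i_inj; rewrite iry linear0.
by exists z; rewrite /= zx xE ps.
Qed.

(* Schanuel's lemma, through the pullback of the two projections to L. *)
Lemma pdim_le_syzygy n L K P (i : {linear K -> P}) (p : {linear P -> L}) :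
  projective P -> short_exact i p -> pdim_le n L -> pdim_le n.-1 K.
Proof.
move=> Pproj ses; case: n => [|n] /=.
  by move=> Lproj; apply: (pdim_le_kernel (n := 0%N) Lproj ses).
move=> [P' [K' [i' [p' [P'proj ses' K'n]]]]].
have [i_inj ex ps] := ses; have [i'_inj ex' ps'] := ses'.
have [|t tE] := @linear_exists R (P * P')%type L (fun x => p x.1 - p' x.2).
  by move=> a u v; rewrite !linearP scalerDr addrACA.
have [//|pr1 pr1E] := @linear_exists R (P * P')%type P fst.
have [//|pr2 pr2E] := @linear_exists R (P * P')%type P' snd.
have [|in1 in1E] := @linear_exists R P (P * P')%type (fun x => (x, 0)).
  by move=> a u v; congr (_, _); rewrite /= scaler0 addr0.
have [|in2 in2E] := @linear_exists R P' (P * P')%type (fun x => (0, x)).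
  by move=> a u v; congr (_, _); rewrite /= scaler0 addr0.
(* The pullback [B] is an extension of [P'] by [K] and also of [P] by [K']. *)
have [B [b [b_inj bP]]] := submodule_exists (submod_ker t).
have [k|f fE] := @inj_factor R _ _ _ b (in1 \o i) b_inj.
  by apply/bP; rewrite tE /= in1E /= (exact_comp0 ex) linear0 subr0.
have [k|f' f'E] := @inj_factor R _ _ _ b (in2 \o i') b_inj.
  by apply/bP; rewrite tE /= in2E /= (exact_comp0 ex') linear0 subr0.
have bt x : p (b x).1 = p' (b x).2.
  by apply/eqP; rewrite -subr_eq0 -tE; apply/eqP/bP; exists x.
apply: (pdim_le_kernel (i := f) (p := pr2 \o b) P'proj).
  split.
  - move=> x y /(congr1 b); rewrite !fE /= !in1E => -[]; exact: i_inj.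
  - move=> x; rewrite /= pr2E; split=> [b2|[k <-]]; last by rewrite fE /= in1E.
    have /ex[k kx] : p (b x).1 = 0 by rewrite bt b2 linear0.
    by exists k; apply: b_inj; rewrite fE /= in1E kx -b2 -surjective_pairing.
  move=> y; have [x xy] := ps (p' y).
  have /bP[z zE] : t (x, y) = 0 by rewrite tE /= xy subrr.
  by exists z; rewrite /= pr2E zE.
apply: (pdim_le_extension (i := f') (p := pr1 \o b) Pproj) K'n.
split.
- move=> x y /(congr1 b); rewrite !f'E /= !in2E => -[]; exact: i'_inj.
- move=> x; rewrite /= pr1E; split=> [b1|[k <-]]; last by rewrite f'E /= in2E.
  have /ex'[k kx] : p' (b x).2 = 0 by rewrite -bt b1 linear0.
  by exists k; apply: b_inj; rewrite f'E /= in2E kx -b1 -surjective_pairing.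
move=> x; have [y yx] := ps' (p x).
have /bP[z zE] : t (x, y) = 0 by rewrite tE /= yx subrr.
by exists z; rewrite /= pr1E zE.
Qed.

Lemma pd_le_pdim n L : pd_le L n -> pdim_le n L.
Proof.
elim: n L => [|n IHn] L [F [d [e [Fproj F0 es exe exd]]]] /=.
  have e_inj : injective e.
    apply: linear_inj_ker => x /exe[y <-]; rewrite (F0 1%N _ y) ?linear0 //.
  have [|e' e'E] := @inj_factor R _ _ _ e idfun e_inj; first exact: es.
  by apply: (projective_retract (i := e') (r := e)) => //; apply: Fproj.
have [K [i ses]] := short_exact_ker es; have [i_inj exi _] := ses.
have [y|e' e'E] := @inj_factor R _ _ _ i (d 0%N) i_inj.
  by apply/exi/exe; exists y.
exists (F 0%N), K, i, e; split=> //; first exact: Fproj.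
apply: IHn; exists (fun i => F i.+1), (fun i => d i.+1), e'; split=> //.
- by move=> j jn; apply: (Fproj j.+1).
- by move=> j jn; apply: (F0 j.+1).
- move=> k; have /exe[y yE] : e (i k) = 0 by apply: (exact_comp0 exi).
  by exists y; apply: i_inj; rewrite e'E.
move=> y; rewrite -exd -e'E; split=> [->|iy]; first by rewrite linear0.
by apply: i_inj; rewrite linear0.
Qed.

Lemma bijectiveP A B (f : {linear A -> B}) :
  injective f -> surjective f -> bijective f.
Proof.
move=> f_inj fs; have [|g gE] := @inj_factor R _ _ _ f idfun f_inj; first exact: fs.
by exists g => x; [apply: f_inj; rewrite gE | rewrite gE].
Qed.

Lemma free_projective L : free_module L -> projective L.
Proof.
move=> [n [f [g fK gK]]].
have [|g' g'E] := @linear_exists R L 'rV[R]_n g.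
  by move=> a u v; apply: (can_inj fK); rewrite linearP !gK.
apply: (projective_retract (i := g') (r := f) _ (@projective_rV n)) => x.
by rewrite g'E gK.
Qed.

Lemma free_fin_gen L : free_module L -> fin_gen L.
Proof.
move=> [n [f [g fK gK]]]; apply: (fin_gen_surj (p := f)) (fin_gen_rV R n).
by move=> x; exists (g x).
Qed.

End ProjectiveDimension.

(** * Ext through free resolutions and their syzygies *)

Section Resolutions.
Local Open Scope ring_scope.
Variable R : comNzRingType.
Implicit Types K L M N G P V Z : lmodType R.

(** With maps out of a free module written as [comb], [mxact] is precomposition with the matrix. *)
Lemma comb_mxact V p q (D : 'M[R]_(p, q)) (u : {ffun 'I_q -> V})
    (w : 'rV[R]_p) :
  comb u (w *m D) = comb (mxact V D u) w.
Proof.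
rewrite /comb; under eq_bigr => a _ do rewrite mxE scaler_suml.
rewrite exchange_big; apply: eq_bigr => b _; rewrite ffunE scaler_sumr.
by apply: eq_bigr => a _; rewrite scalerA.
Qed.

Lemma mxactE V p q (D : 'M[R]_(p, q)) (f : {linear 'rV[R]_q -> V}) b :
  mxact V D [ffun a => f (delta_mx 0 a)] b = f (delta_mx 0 b *m D).
Proof.
rewrite (combE f) -rowE /comb ffunE; apply: eq_bigr => a _.
by rewrite ffunE mxE.
Qed.

(** Dropping the first term of [F] leaves a resolution of the syzygy with the same matrices, so the
    Ext modules are the same up to the shift. *)
Lemma resolution_shift M (F : free_resolution M) :
  exists Z (f : {linear Z -> 'rV[R]_(rk F 0)}) (F' : free_resolution Z),
    [/\ short_exact f (aug F),
        forall N i, zero_module (Ext N F' i.+1) <-> zero_module (Ext N F i.+2)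
      & exists2 t : {linear 'rV[R]_(rk F 1) -> Z}, surjective t &
          exact_at (@mulmxr R 1 _ _ (diff F 1)) t /\
          forall w, f (t w) = w *m diff F 0].
Proof.
have [Z [f ses]] := short_exact_ker (aug_surj F); have [f_inj exf _] := ses.
have [w|t tE] := @inj_factor R _ _ _ f (@mulmxr R 1 _ _ (diff F 0)) f_inj.
  by apply/exf/(exact_aug (f := F)); exists w.
have ts : surjective t.
  move=> z; have /(exact_aug (f := F))[w wE] : aug F (f z) = 0.
    exact: (exact_comp0 exf).
  by exists w; apply: f_inj; rewrite tE.
have ext : exact_at (@mulmxr R 1 _ _ (diff F 1)) t.
  move=> w; rewrite -(exact_diff (f := F)) -tE; split=> [->|tw].
    by rewrite linear0.
  by apply: f_inj; rewrite tw linear0.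
by exists Z, f, (FreeResolution ts ext (fun i => @exact_diff _ _ F i.+1)); split=> //;
  exists t.
Qed.

Lemma ext_zero_extend M N (F : free_resolution M) Z
    (f : {linear Z -> 'rV[R]_(rk F 0)}) :
    short_exact f (aug F) -> zero_module (Ext N F 1) ->
  forall psi : {linear Z -> N},
  exists phi : {linear 'rV[R]_(rk F 0) -> N}, forall z, phi (f z) = psi z.
Proof.
move=> [f_inj exf _] /homology_eq0 E1 psi.
have [w|t tE] := @inj_factor R _ _ _ f (@mulmxr R 1 _ _ (diff F 0)) f_inj.
  by apply/exf/(exact_aug (f := F)); exists w.
(* The pullback of [psi] to the free module of index 1 is a cocycle; its primitive [u] defines the
   extension. *)
have [|u uE] := E1 [ffun b => (psi \o t) (delta_mx 0 b)].
  apply/ffunP => a; rewrite mxactE ffunE /=.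
  suff -> : t (delta_mx 0 a *m diff F 1) = 0 by rewrite linear0.
  apply: f_inj; rewrite tE linear0; apply/(exact_diff (f := F)).
  by exists (delta_mx 0 a).
exists (comb u) => z.
have /(exact_aug (f := F))[w wE] : aug F (f z) = 0 by apply: (exact_comp0 exf).
have <- : t w = z by apply: f_inj; rewrite tE.
rewrite tE /= comb_mxact uE; apply: esym; apply: etrans (combE (psi \o t) w) _.
by apply: eq_bigr => b _; rewrite ffunE.
Qed.

(** In degree one the augmentation splits, so maps from the syzygy extend; higher degrees shift to
    the syzygy, a summand of a free module. *)
Lemma projective_ext_zero M N (F : free_resolution M) i :
  projective M -> zero_module (Ext N F i.+1).
Proof.
elim: i M F => [|i IHi] M F Mproj;
  have [Z [f [F' [ses EF [t ts [ext tE]]]]]] := resolution_shift F.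
  apply/homology_eq0 => y y0.
  have [w /ext[v <-]|psi psiE] := @surj_factor R _ _ _ t (comb y) ts.
    by rewrite /= comb_mxact y0 /comb big1 // => a _; rewrite ffunE scaler0.
  have [_ [r [_ rf _]]] := short_exact_split Mproj ses.
  exists [ffun a => (psi \o r) (delta_mx 0 a)]; apply/ffunP => b.
  by rewrite mxactE /= -tE rf psiE; apply: comb_delta.
apply: (proj1 (EF N i)); apply: IHi.
exact: (pdim_le_kernel (n := 0%N) Mproj ses (@projective_rV R _)).
Qed.

(** Extendability is independent of the cover of [L]: lift each cover through the other; the round
    trip on [G] differs from the identity by a map [c] into [K]. This carries Ext^1 vanishing over
    to a minimal cover. *)
Lemma extend_transfer L N Z P K G (f : {linear Z -> P}) (p : {linear P -> L})
    (g : {linear K -> G}) (q : {linear G -> L}) :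
    short_exact f p -> short_exact g q -> projective P -> projective G ->
    (forall psi : {linear Z -> N}, exists phi : {linear P -> N},
       forall z, phi (f z) = psi z) ->
  forall psi : {linear K -> N}, exists phi : {linear G -> N},
    forall k, phi (g k) = psi k.
Proof.
move=> [f_inj exf ps] [g_inj exg qs] Pproj Gproj ext psi.
have [alpha alphaE] := Pproj _ _ q p qs; have [beta betaE] := Gproj _ _ p q ps.
have [z|a aE] := @inj_factor R _ _ _ g (alpha \o f) g_inj.
  by apply/exg; rewrite /= alphaE (exact_comp0 exf).
have [x|c cE] := @inj_factor R _ _ _ g (idfun \- (alpha \o beta)) g_inj.
  by apply/exg; rewrite /= linearB alphaE betaE subrr.
have [phi phiE] := ext (psi \o a).
exists ((phi \o beta) \+ (psi \o c)) => k /=.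
have /exf[z zE] : p (beta (g k)) = 0 by rewrite betaE (exact_comp0 exg).
have -> : c (g k) = k - a z by apply: g_inj; rewrite cE /= linearB aE /= zE.
by rewrite -zE phiE /= linearB addrC subrK.
Qed.

End Resolutions.

(** * Minimal covers and freeness over a local ring *)

Section LocalFree.
Local Open Scope ring_scope.
Variables (R : comNzRingType) (m : R^o -> Prop).
Hypotheses (Rn : noetherian R) (Rloc : local_at m).
Implicit Types L M N K : lmodType R.

(** With the least number of generators, a relation with a unit coefficient would make one generator
    redundant. *)
Lemma minimal_cover L : fin_gen L -> exists n (s : 'I_n -> L),
  surjective (comb s) /\ forall u, comb s u = 0 -> forall i, m (u 0 i).
Proof.
move=> /fin_genP[n0 [s0 s0L]].
have ex : exists n, `[< exists s : 'I_n -> L, surjective (comb s) >].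
  by exists n0; apply/asboolP; exists s0.
case: (ex_minnP ex) => n /asboolP[s sL] n_min; exists n, s; split=> // u su i.
apply: contrapT => nmu; have [_ _ /(_ _ nmu)[y yu]] := Rloc.
case: n s sL n_min u su i nmu yu => [|n] s sL n_min u su i nmu yu.
  by case: i nmu yu.
have : (n.+1 <= n)%N; last by rewrite ltnn.
apply: n_min; apply/asboolP; exists (fun j => s (lift i j)) => v.
have [w <-] := sL v.
have sE (a : 'rV_n.+1) : comb s a =
    a 0 i *: s i + \sum_j a 0 (lift i j) *: s (lift i j).
  by rewrite /comb (bigD1_ord i).
have si : s i = \sum_j (- (y * u 0 (lift i j))) *: s (lift i j).
  under eq_bigr => j _ do rewrite scaleNr -scalerA.
  rewrite sumrN -scaler_sumr -[LHS]scale1r -yu -scalerA -scalerN; congr (_ *: _).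
  by apply/eqP; rewrite -addr_eq0 -sE su.
exists (\row_j (w 0 (lift i j) - w 0 i * (y * u 0 (lift i j)))).
rewrite comb_row sE si scaler_sumr -big_split /=; apply: eq_bigr => j _.
by rewrite scalerBl addrC scalerA mulrN scaleNr.
Qed.

Lemma fin_gen_nakayama N : fin_gen N ->
    (forall v : N, exists k (a : 'I_k -> R) (u : 'I_k -> N),
      (forall i, m (a i)) /\ v = \sum_i a i *: u i) ->
  zero_module N.
Proof.
move=> /fin_genP[n [s sN]] mN v.
apply: (nakayama (Z := fun=> True) (B := fun v => v = 0) (s := s) Rloc) => //.
- by split=> // a x y -> ->; rewrite scaler0 addr0.
- move=> z _; have [u <-] := sN z; exists (u 0), 0; split=> //.
  by rewrite addr0.
move=> z _; have [k [a [u [ma ->]]]] := mN z; exists k, a, u, 0; split=> //.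
by rewrite addr0.
Qed.

(** A minimal cover splits; retracting onto its kernel [K], which has coordinates in [m], gives K =
    mK, so K = 0. *)
Lemma projective_free L : fin_gen L -> projective L -> free_module L.
Proof.
move=> fgL Lproj; have [n [s [sL sm]]] := minimal_cover fgL.
have [K [f ses]] := short_exact_ker sL; have [f_inj exf _] := ses.
have [_ [r [_ rf _]]] := short_exact_split Lproj ses.
have K0 : zero_module K.
  apply: fin_gen_nakayama; first exact: fin_gen_inj f_inj (fin_gen_rV R n).
  move=> z; exists n, (fun i => f z 0 i), (fun i => r (delta_mx 0 i)); split.
    by apply: sm; apply: (exact_comp0 exf).
  by rewrite -[LHS]rf [LHS]combE.
exists n, (comb s); apply: bijectiveP sL; apply: linear_inj_ker => u /exf[z <-].
by rewrite (K0 z) linear0.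
Qed.

Lemma pdim_ext_free n L N (F : free_resolution L) :
    fin_gen N -> ~ zero_module N -> fin_gen L -> pdim_le n L ->
    (forall i, zero_module (Ext N F i.+1)) ->
  free_module L.
Proof.
move=> fgN N0; elim: n L F => [|n IHn] L F fgL Ln LN; first exact: projective_free.
have [Z [f [F' [ses EF _]]]] := resolution_shift F; have [f_inj _ _] := ses.
have Zfree : free_module Z.
  apply: (IHn Z F').
  - exact: fin_gen_inj f_inj (fin_gen_rV R _).
  - exact: pdim_le_syzygy (@projective_rV R _) ses Ln.
  by move=> i; apply: (proj2 (EF N i)).
(* The syzygy in [F] is free by induction, so the kernel of a minimal cover is free as well. *)
have L1 : pdim_le 1 L.
  exists 'rV[R]_(rk F 0), Z, f, (aug F); split=> //; first exact: (@projective_rV R).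
  exact: free_projective.
have [k [s [sL sm]]] := minimal_cover fgL.
have [K [g sesK]] := short_exact_ker sL; have [g_inj exg _] := sesK.
have [l [h h_bij]] : free_module K.
  apply: projective_free; first exact: fin_gen_inj g_inj (fin_gen_rV R k).
  exact: pdim_le_syzygy (@projective_rV R k) sesK L1.
have ext := extend_transfer ses sesK (@projective_rV R _) (@projective_rV R k)
  (ext_zero_extend ses (LN 0%N)).
exists k, (comb s); apply: bijectiveP sL; apply: linear_inj_ker => u /exg[z <-].
have [h' hK h'K] := h_bij; case: l h h_bij h' hK h'K => [|l] h h_bij h' hK h'K.
  by rewrite -[z]h'K (thinmx0 (h' z)) !linear0.
case: N0; apply: fin_gen_nakayama => // v.
have [|c cE] := @inj_factor R _ _ _ h idfun (can_inj hK).
  by move=> d; exists (h' d); rewrite h'K.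
(* If [K] had a basis vector, the map sending all basis vectors to [v] would extend to [phi]; the
   coordinates of that basis vector lie in [m], so [v] lies in mN. *)
have [phi phiE] := ext (comb (fun=> v) \o (c : {linear K -> 'rV[R]_l.+1})).
pose x := g (h (delta_mx 0 ord0)).
exists k, (x 0), (fun i => phi (delta_mx 0 i)); split.
  by apply: sm; apply: (exact_comp0 exg).
rewrite -[RHS](combE phi) phiE /= [c _](_ : _ = delta_mx 0 ord0) ?comb_delta //.
by apply: (can_inj hK); rewrite cE.
Qed.

End LocalFree.

(** * Free and totally reflexive modules *)

Section FreeModules.
Local Open Scope ring_scope.
Variable R : comNzRingType.
Implicit Types K G L N X V : lmodType R.

Lemma zero_injective V : zero_module V -> injective_module V.
Proof. by move=> V0 A B g f _; exists \0 => x; rewrite (V0 (f x)). Qed.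

Lemma dual_basis L : free_module L ->
  exists n (b : 'I_n -> L) (c : 'I_n -> LinHom L R^o),
    forall x, x = \sum_k (c k x : R) *: b k.
Proof.
move=> [n [f [g fK gK]]].
have [|g' g'E] := @linear_exists R L 'rV[R]_n g.
  by move=> a u v; apply: (can_inj fK); rewrite linearP !gK.
have /choice[c cE] : forall k, exists c : {linear L -> R^o},
    forall x, c x = g' x 0 k.
  by move=> k; apply: linear_exists => a u v; rewrite linearP !mxE.
exists n, (fun k => f (delta_mx 0 k)), c => x; rewrite -{1}[x]gK combE.
by apply: eq_bigr => k _; rewrite cE g'E.
Qed.

(** The coordinates of a cocycle are cocycles with values in [R]; their primitives reassemble along
    the basis of [N]. *)
Lemma ext_zero_coef_free X N (F : free_resolution X) i :
  free_module N -> zero_module (Ext R^o F i.+1) -> zero_module (Ext N F i.+1).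
Proof.
move=> /dual_basis[n [b [c cE]]] /homology_eq0 X0; apply/homology_eq0 => y y0.
have /choice[u uE] : forall k, exists u, mxact R^o (diff F i) u = [ffun a => c k (y a)].
  move=> k; apply: X0; apply/ffunP => a; rewrite !ffunE.
  under eq_bigr => j _ do rewrite ffunE -linearZ_LR.
  rewrite -linear_sum; move/ffunP: y0 => /(_ a); rewrite !ffunE => ->.
  by rewrite linear0.
exists [ffun a => \sum_k (u k a : R) *: b k]; apply/ffunP => a; rewrite ffunE.
under eq_bigr => j _ do rewrite ffunE scaler_sumr.
rewrite exchange_big [RHS]cE; apply: eq_bigr => k _.
have /ffunP/(_ a) := uE k; rewrite !ffunE => <-; rewrite scaler_suml.
by apply: eq_bigr => j _; rewrite scalerA.
Qed.

Lemma free_totally_reflexive L : free_module L -> totally_reflexive L.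
Proof.
move=> Lfree; have Lproj := free_projective Lfree.
have [n [b [c cE]]] := dual_basis Lfree.
have homE (g : LinHom L R^o) : g = \sum_k (g (b k) : R) *: c k.
  apply: Hom_ext => x; rewrite hom_sumE [in LHS](cE x) linear_sum.
  by apply: eq_bigr => k _; rewrite linearZ_LR [LHS]mulrC.
split.
- exact: free_fin_gen.
- pose inv (h : LinHom (LinHom L R^o) R^o) : L := \sum_k (h (c k) : R) *: b k.
  exists inv => [x|h]; first by rewrite [RHS]cE.
  apply: Hom_ext => g; rewrite {2}(homE g) linear_sum.
  rewrite [LHS](linear_sum g); apply: eq_bigr => k _.
  by rewrite !linearZ_LR [LHS]mulrC.
- by case=> // i _ F; apply: projective_ext_zero.
case=> // i _ F; apply: projective_ext_zero.
(* The dual of [L] is a retract of a free module, hence projective. *)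
have [|f fE] := @linear_exists R (LinHom L R^o) 'rV[R]_n
    (fun g => \row_k (g (b k) : R)).
  by move=> a g h; apply/rowP => k; rewrite !mxE.
apply: (projective_retract (i := f) (r := comb c) _ (@projective_rV R n)) => g.
by rewrite fE [RHS]homE; apply: comb_row.
Qed.

Lemma left_resolution_cons (P : lmodType R -> Prop) n X G K
    (i : {linear K -> G}) (p : {linear G -> X}) :
    P G -> short_exact i p -> left_resolution_le P K n ->
  left_resolution_le P X n.+1.
Proof.
move=> PG [i_inj ex ps] [F [d [e [PF F0 es exe exd]]]].
pose F' j := if j is k.+1 then F k else G.
pose d' j : {linear F' j.+1 -> F' j} :=
  match j return {linear F' j.+1 -> F' j} with
  | 0 => i \o e
  | k.+1 => d k
  end.
exists F', d', p; split=> //.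
- by case=> // j; apply: PF.
- by case=> // j; apply: F0.
- move=> v; rewrite ex; split=> [[k <-]|[u <-]]; last by exists (e u).
  by have [u <-] := es k; exists u.
case=> [|j] /=; last exact: exd.
move=> v; rewrite -exe /=; split=> [ev|->]; last by rewrite linear0.
by apply: i_inj; rewrite ev linear0.
Qed.

Lemma left_resolution_0 (P : lmodType R -> Prop) X : P X -> left_resolution_le P X 0.
Proof.
move=> PX; pose F j : lmodType R := if j is _.+1 then 'rV[R]_0 else X.
have F0 j (v : F j.+1) : v = 0 by apply: thinmx0.
exists F, (fun j => \0 : {linear F j.+1 -> F j}), idfun; split=> //.
- by case.
- by case=> // j _ v; apply: F0.
- by move=> v; exists v.
- move=> v; split=> [v0|[u <-]]; last by rewrite linear0.
  by exists 0; rewrite [RHS]v0.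
by move=> j v; split=> [_|[u <-] //]; exists 0; rewrite (F0 _ v).
Qed.

(** Totally reflexive modules are finitely generated, while the projectives in [pdim_le] may not be,
    so finite free covers are chosen afresh; the last syzygy is projective, hence free. *)
Lemma pdim_le_Gdim (m : R^o -> Prop) n X : noetherian R -> local_at m ->
  fin_gen X -> pdim_le n X -> Gdim_le X n.
Proof.
move=> Rn Rloc; elim: n X => [|n IHn] X fgX Xn.
  exact/left_resolution_0/free_totally_reflexive/(projective_free Rn Rloc).
have /fin_genP[k [s sX]] := fgX.
have [K [f ses]] := short_exact_ker sX; have [f_inj _ _] := ses.
apply: (left_resolution_cons _ ses).
  by apply: free_totally_reflexive; exists k, idfun; exists idfun.
apply: IHn; first exact: fin_gen_inj f_inj (fin_gen_rV R k).
exact: pdim_le_syzygy (@projective_rV R k) ses Xn.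
Qed.

Lemma krull_dim_unique d d' : krull_dim R d -> krull_dim R d' -> d = d'.
Proof.
move=> [[p pP] dmax] [[p' p'P] d'max]; apply/eqP; rewrite eqn_leq.
by rewrite (d'max _ p) ?(dmax _ p').
Qed.

Lemma free_of_test_dual (m : idealr R) (W M N : lmodType R) :
    noetherian R -> local_ring m -> fin_gen W -> finite_id W ->
    fin_gen M -> fin_gen N -> ~ zero_module N ->
    (exists t, depth m R^o t /\ depth m N t) ->
    (forall j, (0 < j)%N -> Ext_vanishes j M N) ->
    test_module (LinHom N W) ->
  free_module M.
Proof.
move=> Rn Rlocal fgW [n [J [e [d [Jinj J0 e_inj exe exd]]]]] fgM fgN N0 dN MN
  [_ test].
have Rloc := local_ring_at Rn Rlocal.
(* Beyond the length of the resolution the terms are zero, hence injective too. *)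
have J_inj i : injective_module (J i).
  by case: (leqP i n) => [/Jinj //|/J0/zero_injective].
have N_ext i : ext_zero d i.+1 N.
  exact: (ext_zero_max_depth J_inj e_inj exe exd J0 Rn Rloc fgW).
have [|p /pd_le_pdim Mp] := test M fgM.
  exists 0%N => -[//|i] _ F.
  apply: (tor_dual_zero J_inj e_inj exe exd J0) => // j; exact: MN.
have [F] := free_resolution_exists Rn fgM.
by apply: (pdim_ext_free Rn Rloc fgN N0 fgM Mp (F := F)) => i; apply: MN.
Qed.

End FreeModules.

Theorem proposition3p5 (R : comNzRingType) (m : idealr R)
    (omega M N : lmodType R)
    (R_noetherian : noetherian R)
    (R_local : local_ring m)
    (R_CM : cohen_macaulay m)
    (omega_canonical : canonical_module m omega)
    (M_fg : fin_gen M)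
    (N_fg : fin_gen N)
    (N_MCM : maximal_CM m N)
    (Ext_M_N : forall j, 0 < j -> Ext_vanishes j M N)
    (N_dagger_test : test_module (LinHom N omega)) :
  free_module M /\ (M = N -> G_regular R).
Proof.
have [[_ omega_fg _] _ omega_id] := omega_canonical.
have [N0 _ [d [dimR depthN]]] := N_MCM.
have [d' [dimR' depthR]] := R_CM.
have deps : exists t, depth m R^o t /\ depth m N t.
  by exists d; split=> //; rewrite (krull_dim_unique dimR dimR').
(* Stated for all [X]: it is applied to [M], then to the terms of a resolution by totally reflexive
   modules. *)
have free_of X : fin_gen X -> (forall j, 0 < j -> Ext_vanishes j X N) ->
    free_module X.
  move=> X_fg XN; exact: (free_of_test_dual R_noetherian R_local omega_fg omega_id
    X_fg N_fg N0 deps XN N_dagger_test).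
have M_free := free_of M M_fg Ext_M_N; split=> // MN.
have N_free : free_module N by rewrite -MN.
move=> X X_fg n; split=> [[F [f [e [FTR F0 es exe exf]]]]|/pd_le_pdim].
  (* The same resolution works: its terms have no higher Ext into [R], hence none into the free
     module [N], so they are free. *)
  exists F, f, e; split=> // i i_n; have [Fi_fg _ FiR _] := FTR i i_n.
  apply/free_projective/free_of => // -[//|j] j0 Fi.
  exact/ext_zero_coef_free/FiR.
exact: pdim_le_Gdim R_noetherian (local_ring_at R_noetherian R_local) X_fg.
Qed.
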